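(* There exists an absolute constant $C_1<\infty$ such that the following holds. Let $b$ be a symbol on $\mathbb R^2$ such that for all $I,J\in\mathcal D$ $$(b, h_I\otimes h_J)\neq 0 \ \Longrightarrow\ I \text{ and } J \text{ are both even}.$$ Then for every dyadic open set $U_0\subset\mathbb R^2$, $$\sum_{I\times J\subset U_0} (b, h_I\otimes h_J)^2 \le C_1 \|\mathcal T^b\|^2\,|U_0|,$$ where the sum is over all dyadic rectangles $I\times J\in\mathcal D\times\mathcal D$ contained in $U_0$.
   Context: $\mathcal D$ is the usual dyadic lattice on $\mathbb R$; $\mathcal D\times\mathcal D$ is the family of dyadic rectangles $R=I\times J$ in $\mathbb R^2$. For $I\in\mathcal D$, $I_+$ and $I_-$ are its right and left halves, and $h_I=|I|^{-1/2}(\mathbf 1_{I_+}-\mathbf 1_{I_-})$ is the Haar function; $(h_I\otimes h_J)(x,y)=h_I(x)h_J(y)$. $(\cdot,\cdot)$ is the $L^2$ pairing, $|\cdot|$ is Lebesgue measure. An interval $I\in\mathcal D$ is called even if $|I|=2^{-2k}$ for some integer $k$, and odd otherwise. The dyadic shift $T_1$ acts on functions of the variable $x$ by $T_1h_I=h_{I_+}-h_{I_-}$ if $I$ is even and $T_1h_I=0$ otherwise (extended linearly and boundedly to $L^2$). $T_2$ is the copy of $T_1$ acting in the variable $y$. Both are regarded as operators on $L^2(\mathbb R^2)$, each acting in its own variable only. A symbol $b$ is a real-valued function in $L^2_{loc}(\mathbb R^2)$, and $b$ also denotes the operator of multiplication by $b$. The repeated commutator is $$\mathcal T^b=[T_2,[T_1,b]]=T_2T_1b-T_2bT_1-T_1bT_2+bT_1T_2,$$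 defined on finite linear combinations of the functions $h_I\otimes h_J$; $\|\mathcal T^b\|$ is its operator norm $L^2(\mathbb R^2)\to L^2(\mathbb R^2)$ ($+\infty$ if it is not bounded). A dyadic open set is a finite union of dyadic rectangles. *)

(* Defs.v *)
(* Square-integrable functions are everywhere defined real functions in
   [Lfun mu 2], and equality in L^2 is equality almost everywhere. *)
From HB Require Import structures.
From mathcomp Require Import all_boot all_order all_algebra.
From mathcomp Require Import all_classical all_reals all_analysis.

Set Implicit Arguments.
Unset Strict Implicit.
Unset Printing Implicit Defensive.

Import Order.TTheory GRing.Theory Num.Theory.
Import numFieldNormedType.Exports.

Local Open Scope classical_set_scope.
Local Open Scope ring_scope.

(* The pair (n, k) stands for the interval [k 2^n, (k+1) 2^n[; this encoding
   of dyadic intervals is injective. *)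
Definition dyadic : Type := (int * int)%type.

Definition dyadic_left (I : dyadic) : dyadic := (I.1 - 1, 2 * I.2).
Definition dyadic_right (I : dyadic) : dyadic := (I.1 - 1, 2 * I.2 + 1).

Section DyadicLine.
Context {R : realType}.

Definition dyadic_length (I : dyadic) : R := 2 ^ I.1.

Definition dyadic_interval (I : dyadic) : set R :=
  `[I.2%:~R * dyadic_length I, (I.2 + 1)%:~R * dyadic_length I[%classic.

Definition haar (I : dyadic) (x : R) : R :=
  (Num.sqrt (dyadic_length I))^-1 *
  (\1_(dyadic_interval (dyadic_right I)) x - \1_(dyadic_interval (dyadic_left I)) x).

End DyadicLine.

Definition dyadic_even (R : realType) (I : dyadic) : Prop :=
  exists k : int, dyadic_length I = 2 ^ (- (2 * k)) :> R.

Section DyadicPlane.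
Context {R : realType}.

Definition lebesgue2 : {measure set (measurableTypeR R * measurableTypeR R) -> \bar R} :=
  (@lebesgue_measure R \x @lebesgue_measure R)%E.

Definition dyadic_rect (Q : dyadic * dyadic) : set (R * R) :=
  dyadic_interval Q.1 `*` dyadic_interval Q.2.

Definition dyadic_open (U : set (R * R)) : Prop :=
  exists s : seq (dyadic * dyadic), U = \big[setU/set0]_(Q <- s) dyadic_rect Q.

Definition tensor (f g : R -> R) (z : R * R) : R := f z.1 * g z.2.

Definition haar2 (Q : dyadic * dyadic) : R * R -> R :=
  tensor (haar Q.1) (haar Q.2).

Definition haar_coef (b : R * R -> R) (Q : dyadic * dyadic) : R :=
  (\int[lebesgue2]_z (b z * haar2 Q z))%R.

Definition haar_span (f : R * R -> R) : Prop :=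
  exists s : seq (R * (dyadic * dyadic)),
    f = (fun z => \sum_(t <- s) t.1 * haar2 t.2 z).

Definition L2loc (b : R * R -> R) : Prop :=
  measurable_fun setT (b : measurableTypeR R * measurableTypeR R -> R) /\
  forall K : set (R * R), compact K ->
    (\int[lebesgue2]_(z in K) (b z ^+ 2)%:E < +oo)%E.

End DyadicPlane.

Definition bounded_linear_L2 d (X : measurableType d) (R : realType)
    (mu : {measure set X -> \bar R}) (T : (X -> R) -> (X -> R)) : Prop :=
  [/\ forall f, f \in Lfun mu 2%:E -> T f \in Lfun mu 2%:E,
      forall (a : R) f g, f \in Lfun mu 2%:E -> g \in Lfun mu 2%:E ->
        T (fun x => a * f x + g x) = (fun x => a * T f x + T g x) %[ae mu] &
      exists C : R, forall f, f \in Lfun mu 2%:E ->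
        ('N[mu]_2%:E[EFin \o T f] <= C%:E * 'N[mu]_2%:E[EFin \o f])%E].

Section Shift.
Context {R : realType}.

(* Such an S exists, and S f is unique a.e. for f in L^2(R), because the Haar
   functions form an orthonormal basis. *)
Definition is_dyadic_shift (S : (R -> R) -> (R -> R)) : Prop :=
  [/\ bounded_linear_L2 (@lebesgue_measure R) S,
      forall I, dyadic_even R I ->
        S (haar I) = (fun x => haar (dyadic_right I) x - haar (dyadic_left I) x)
          %[ae @lebesgue_measure R] &
      forall I, ~ dyadic_even R I -> S (haar I) = cst 0 %[ae @lebesgue_measure R]].

(* S \otimes Id and Id \otimes S: the bounded operators on L^2(R^2) with the
   expected values on elementary tensors, whose span is dense. *)
Definition acts_in_x (S : (R -> R) -> (R -> R))
    (T : (R * R -> R) -> (R * R -> R)) : Prop :=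
  bounded_linear_L2 (@lebesgue2 R) T /\
  forall f g, f \in Lfun (@lebesgue_measure R) 2%:E ->
    g \in Lfun (@lebesgue_measure R) 2%:E ->
    T (tensor f g) = tensor (S f) g %[ae @lebesgue2 R].

Definition acts_in_y (S : (R -> R) -> (R -> R))
    (T : (R * R -> R) -> (R * R -> R)) : Prop :=
  bounded_linear_L2 (@lebesgue2 R) T /\
  forall f g, f \in Lfun (@lebesgue_measure R) 2%:E ->
    g \in Lfun (@lebesgue_measure R) 2%:E ->
    T (tensor f g) = tensor f (S g) %[ae @lebesgue2 R].

Definition mulop (b f : R * R -> R) : R * R -> R := fun z => b z * f z.

Definition commutator (A B : (R * R -> R) -> (R * R -> R))
    (f : R * R -> R) : R * R -> R := fun z => A (B f) z - B (A f) z.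

Definition repeated_commutator (T1 T2 : (R * R -> R) -> (R * R -> R))
    (b : R * R -> R) : (R * R -> R) -> (R * R -> R) :=
  commutator T2 (commutator T1 (mulop b)).

(* Norm of an operator initially defined on the span of the Haar functions,
   which is dense in L^2(R^2). *)
Definition haar_opnorm (T : (R * R -> R) -> (R * R -> R)) : \bar R :=
  ereal_sup [set 'N[@lebesgue2 R]_2%:E[EFin \o T f]%E | f in
    [set f | haar_span f /\ ('N[@lebesgue2 R]_2%:E[EFin \o f] <= 1)%E]].

End Shift.

(* Main.v *)
Require Import Defs.
From HB Require Import structures.
From mathcomp Require Import all_boot all_order all_algebra.
From mathcomp Require Import all_classical all_reals all_analysis.
From mathcomp Require Import measurable_realfun ring lra zify.
From mathcomp Require finmap.

Set Implicit Arguments.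
Unset Strict Implicit.
Unset Printing Implicit Defensive.

Import Order.TTheory GRing.Theory Num.Theory.
Import numFieldNormedType.Exports.

Local Open Scope classical_set_scope.
Local Open Scope ring_scope.

(** Write T for the dyadic shift, so that T h_I = h_{I+} - h_{I-} when I is even
    and T h_I = 0 when I is odd. It maps even Haar functions to odd ones, it kills
    the odd ones, and on the even part of L^2 it is sqrt 2 times an isometry. Hence
      (T g, T h_I) = 2 (g, h_I)   for every g in L^2 and every even I
    ([shift_adjoint], [acts_in_x_adjoint], [acts_in_y_adjoint]; both sides are
    bounded functionals of g, so this is checked on the Haar system, whose
    completeness is [haar_complete] and [tensor_complete]).

    Let C be the repeated commutator, I and J even, Q = I x J and f in the span of
    the Haar functions. The identity above removes T_1 and T_2 from in front of b
    in (C f, T h_I (x) T h_J), and what remains is the integral of b against a step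
    function. For f = u (x) v this step function is k_I(u) (x) k_J(v), with
      k_I(u) = 2 u h_I - (T u) (T h_I)
    ([commutator_pairing]). The product of two distinct Haar functions is a multiple
    of the one with the shorter interval, and (T h_I)^2 = 2 h_I^2 = 2 |I|^-1 1_I.
    Therefore k_I(u) equals, up to odd Haar functions, twice the mean-zero part
    u h_I - (u, h_I) |I|^-1 1_I ([kern_core]). The symbol is orthogonal to every
    product of Haar functions one of which is odd, so the odd terms are invisible to
    it ([sform_kern]). If f = 1 on Q, then the product of the mean-zero parts in the
    two variables is h_I (x) h_J itself ([tensor_sum_cores]), and so
      (C f, T h_I (x) T h_J) = 4 (b, h_I (x) h_J).

    The functions T h_I (x) T h_J are orthogonal with squared norm 4, and one f
    serves all rectangles contained in U_0 at once. Bessel's inequality bounds the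
    sum of the squares of the coefficients by |C f|^2, hence by |C|^2 |f|^2 up to a constant.
    It remains to find f in the Haar span, equal to 1 on U_0, with |f|^2 <= 16 |U_0|
    ([exists_test_function]). The indicator of U_0 does not have mean zero on lines,
    so three translates of it, moved outside a large square that contains U_0, are
    subtracted or added. *)

(** * The real Hilbert space structure of square-integrable functions *)

Section L2.
Context d (X : measurableType d) (R : realType).
Variable mu : {measure set X -> \bar R}.
Implicit Types f g : X -> R.

Definition ip f g : R := (\int[mu]_x (f x * g x))%R.

Lemma L2_measurable f : f \in Lfun mu 2%:E -> measurable_fun setT f.
Proof. by move=> /andP[/[!inE]]. Qed.

Lemma sqr_Lnorm f :
  ('N[mu]_2%:E[EFin \o f] ^+ 2 = \int[mu]_x (f x ^+ 2)%:E)%E.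
Proof.
have N0 : (0 <= 'N[mu]_2%:E[EFin \o f])%E by exact: Lnorm_ge0.
transitivity ('N[mu]_2%:E[EFin \o f] `^ 2)%E.
  case: ('N[mu]_2%:E[EFin \o f])%E N0 => [r|//|//]; rewrite ?lee_fin => r0.
    by rewrite poweR_EFin -EFin_expe powR_mulrn.
  by rewrite poweRyr // expe2 mulyy.
rewrite poweR_Lnorm //; apply: eq_integral => x _ /=.
by rewrite powR_mulrn // real_normK ?num_real.
Qed.

Lemma L2P f : f \in Lfun mu 2%:E <->
  measurable_fun setT f /\ (\int[mu]_x (f x ^+ 2)%:E < +oo)%E.
Proof.
have N0 : (0 <= 'N[mu]_2%:E[EFin \o f])%E by exact: Lnorm_ge0.
split=> [fL|[mf fy]].
  split; first exact: L2_measurable.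
  rewrite -sqr_Lnorm; move: fL => /andP[_ /[!inE]] /=; rewrite /finite_norm.
  by case: ('N[mu]_2%:E[EFin \o f])%E N0 => [r|//|//] _ _; rewrite -EFinM ltry.
apply/andP; split; rewrite inE //= /finite_norm.
move: fy; rewrite -sqr_Lnorm.
by case: ('N[mu]_2%:E[EFin \o f])%E N0 => [r|//|//] _; rewrite ?ltry ?expe2 ?mulyy.
Qed.

Lemma L2_integrableM f g : f \in Lfun mu 2%:E -> g \in Lfun mu 2%:E ->
  mu.-integrable setT (fun x => (f x * g x)%:E).
Proof. by move=> fL gL; apply/Lfun1_integrable/Lfun2_mul_Lfun1. Qed.

Lemma ip_sqr f : f \in Lfun mu 2%:E -> (ip f f)%:E = (\int[mu]_x (f x ^+ 2)%:E)%E.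
Proof.
move=> fL; rewrite /ip /Rintegral fineK.
  by apply: eq_integral => x _; rewrite expr2.
exact: integrable_fin_num (L2_integrableM fL fL).
Qed.

Lemma L2_lin a f g : f \in Lfun mu 2%:E -> g \in Lfun mu 2%:E ->
  (fun x => a * f x + g x) \in Lfun mu 2%:E.
Proof.
move=> fL gL; have p1 : (1 <= 2%:E :> \bar R)%E by rewrite lee_fin ler1n.
exact: (Lfun_submod_closed mu p1).2 a f g fL gL.
Qed.

Lemma L20 : (fun=> 0) \in Lfun mu 2%:E.
Proof.
by apply/L2P; split=> //; under eq_integral do rewrite expr0n /=; rewrite integral0 ltry.
Qed.

Lemma L2D f g : f \in Lfun mu 2%:E -> g \in Lfun mu 2%:E ->
  (fun x => f x + g x) \in Lfun mu 2%:E.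
Proof.
by move=> fL gL; have := L2_lin 1 fL gL; under eq_fun do rewrite mul1r.
Qed.

Lemma L2Z a f : f \in Lfun mu 2%:E -> (fun x => a * f x) \in Lfun mu 2%:E.
Proof.
by move=> fL; have := L2_lin a fL L20; under eq_fun do rewrite addr0.
Qed.

Lemma L2B f g : f \in Lfun mu 2%:E -> g \in Lfun mu 2%:E ->
  (fun x => f x - g x) \in Lfun mu 2%:E.
Proof.
move=> fL gL; have := L2_lin (-1) gL fL.
by under eq_fun do rewrite mulN1r addrC.
Qed.

Lemma L2_sum (I : eqType) (s : seq I) (F : I -> X -> R) :
  (forall i, i \in s -> F i \in Lfun mu 2%:E) ->
  (fun x => \sum_(i <- s) F i x) \in Lfun mu 2%:E.
Proof.
elim: s => [|i s IH] H; first by under eq_fun do rewrite big_nil; exact: L20.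
under eq_fun do rewrite big_cons; apply: L2D; first by rewrite H ?mem_head.
by apply: IH => j js; rewrite H // inE js orbT.
Qed.

Lemma L2_ae f g : measurable_fun setT f -> g \in Lfun mu 2%:E ->
  f = g %[ae mu] -> f \in Lfun mu 2%:E.
Proof.
move=> mf /L2P[mg gy] fg; apply/L2P; split=> //.
rewrite (ae_eq_integral (fun x => (g x ^+ 2)%:E)) //.
- by apply/measurable_EFinP; exact: measurable_funX.
- by apply/measurable_EFinP; exact: measurable_funX.
- by apply: filterS fg => x /= + _ => ->.
Qed.

Lemma ipC f g : ip f g = ip g f.
Proof. by rewrite /ip; apply: eq_Rintegral => x _; rewrite mulrC. Qed.

Lemma ip_ext f f' g : f =1 f' -> ip f g = ip f' g.
Proof. by move=> ff'; apply: eq_Rintegral => x _; rewrite ff'. Qed.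

Lemma ip_ae f f' g : f \in Lfun mu 2%:E -> f' \in Lfun mu 2%:E ->
  g \in Lfun mu 2%:E -> f = f' %[ae mu] -> ip f g = ip f' g.
Proof.
move=> fL f'L gL ff'; congr fine; apply: ae_eq_integral => //.
- exact: measurable_int (L2_integrableM fL gL).
- exact: measurable_int (L2_integrableM f'L gL).
- by apply: filterS ff' => x /= + _ => ->.
Qed.

Lemma ip_linl a f f' g : f \in Lfun mu 2%:E -> f' \in Lfun mu 2%:E ->
  g \in Lfun mu 2%:E ->
  ip (fun x => a * f x + f' x) g = a * ip f g + ip f' g.
Proof.
move=> fL f'L gL; rewrite /ip.
under eq_Rintegral do rewrite mulrDl -mulrA.
rewrite RintegralD //; last 2 first.
- by have := L2_integrableM (L2Z a fL) gL; under eq_fun do rewrite -mulrA.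
- exact: L2_integrableM.
by rewrite RintegralZl //; exact: L2_integrableM.
Qed.

Lemma ip0l g : ip (fun=> 0) g = 0.
Proof.
rewrite /ip; under eq_Rintegral do rewrite mul0r.
by rewrite /Rintegral integral0.
Qed.

Lemma ipZl a f g : f \in Lfun mu 2%:E -> g \in Lfun mu 2%:E ->
  ip (fun x => a * f x) g = a * ip f g.
Proof.
move=> fL gL; have := ip_linl a fL L20 gL; rewrite ip0l addr0 => <-.
by apply: ip_ext => x; rewrite addr0.
Qed.

Lemma ipDl f f' g : f \in Lfun mu 2%:E -> f' \in Lfun mu 2%:E ->
  g \in Lfun mu 2%:E -> ip (fun x => f x + f' x) g = ip f g + ip f' g.
Proof.
move=> fL f'L gL; have := ip_linl 1 fL f'L gL; rewrite mul1r => <-.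
by apply: ip_ext => x; rewrite mul1r.
Qed.

Lemma ipBl f f' g : f \in Lfun mu 2%:E -> f' \in Lfun mu 2%:E ->
  g \in Lfun mu 2%:E -> ip (fun x => f x - f' x) g = ip f g - ip f' g.
Proof.
move=> fL f'L gL; have := ip_linl (-1) f'L fL gL; rewrite mulN1r addrC => <-.
by apply: ip_ext => x; rewrite mulN1r addrC.
Qed.

Lemma ip_suml (I : eqType) (s : seq I) (F : I -> X -> R) g :
  (forall i, i \in s -> F i \in Lfun mu 2%:E) -> g \in Lfun mu 2%:E ->
  ip (fun x => \sum_(i <- s) F i x) g = \sum_(i <- s) ip (F i) g.
Proof.
elim: s => [|i s IH] H gL.
  by rewrite big_nil -[RHS](ip0l g); apply: ip_ext => x; rewrite big_nil.
have Hs j : j \in s -> F j \in Lfun mu 2%:E.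
  by move=> js; rewrite H // inE js orbT.
rewrite big_cons -IH // -ipDl ?H ?mem_head //; last exact: L2_sum.
by apply: ip_ext => x; rewrite big_cons.
Qed.

Lemma ip_ge0 f : 0 <= ip f f.
Proof. by apply: Rintegral_ge0 => x _; rewrite -expr2 sqr_ge0. Qed.

Lemma ip_quadratic a f g : f \in Lfun mu 2%:E -> g \in Lfun mu 2%:E ->
  ip (fun x => a * f x + g x) (fun x => a * f x + g x) =
  a ^+ 2 * ip f f + 2 * a * ip f g + ip g g.
Proof.
move=> fL gL; have hL := L2_lin a fL gL.
have E k : k \in Lfun mu 2%:E -> ip k (fun x => a * f x + g x) = a * ip f k + ip g k.
  by move=> kL; rewrite ipC ip_linl.
by rewrite ip_linl // !E // [ip g f]ipC; ring.
Qed.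

Lemma cauchy_schwarz f g : f \in Lfun mu 2%:E -> g \in Lfun mu 2%:E ->
  ip f g ^+ 2 <= ip f f * ip g g.
Proof.
move=> fL gL.
have H a : 0 <= a ^+ 2 * ip f f + 2 * a * ip f g + ip g g.
  by rewrite -ip_quadratic // ip_ge0.
have := ip_ge0 f; rewrite le_eqVlt => /predU1P[f0|f0]; last first.
  have := H (- ip f g / ip f f).
  rewrite -(pmulr_rge0 _ f0).
  suff -> : ip f f * ((- ip f g / ip f f) ^+ 2 * ip f f +
    2 * (- ip f g / ip f f) * ip f g + ip g g) = ip f f * ip g g - ip f g ^+ 2.
    by rewrite subr_ge0.
  by field; rewrite gt_eqF.
rewrite -f0 mul0r; have [->|fg0] := eqVneq (ip f g) 0; first by rewrite expr0n.
have := H (- (ip g g + 1) / (2 * ip f g)); rewrite -f0.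
have -> : (- (ip g g + 1) / (2 * ip f g)) ^+ 2 * 0 +
   2 * (- (ip g g + 1) / (2 * ip f g)) * ip f g + ip g g = -1.
  by field.
by rewrite oppr_ge0 ler10.
Qed.

(** This is the positivity of the squared norm of f - k^-1 sum_i (f, G_i) G_i. Only
    an upper bound on the norms is asked for, so that some G_i may vanish. *)
Lemma bessel (I : eqType) (s : seq I) (G : I -> X -> R) (k : R) f :
  0 < k -> uniq s -> f \in Lfun mu 2%:E -> (forall i, G i \in Lfun mu 2%:E) ->
  (forall i, i \in s -> ip (G i) (G i) <= k) ->
  (forall i j, i \in s -> j \in s -> i != j -> ip (G i) (G j) = 0) ->
  \sum_(i <- s) ip f (G i) ^+ 2 <= k * ip f f.
Proof.
move=> k0 us fL GL Gk G0.
pose p x := \sum_(i <- s) ip f (G i) * G i x.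
have pL : p \in Lfun mu 2%:E by apply: L2_sum => i _; exact: L2Z.
have pG i : i \in s -> ip p (G i) = ip f (G i) * ip (G i) (G i).
  move=> si; rewrite /p ip_suml // => [|j _]; last exact: L2Z.
  rewrite (bigD1_seq i) //= big_seq_cond big1 ?addr0 ?ipZl // => j /andP[sj ji].
  by rewrite ipZl // G0 // mulr0.
have fp : ip f p = \sum_(i <- s) ip f (G i) ^+ 2.
  rewrite ipC /p ip_suml // => [|j _]; last exact: L2Z.
  by apply: eq_bigr => i _; rewrite ipZl // [ip _ f]ipC expr2.
have pp : ip p p <= k * ip f p.
  rewrite fp {2}/p ipC ip_suml // => [|j _]; last exact: L2Z.
  rewrite mulr_sumr big_seq [leRHS]big_seq ler_sum // => i si.
  rewrite ipZl // [ip _ p]ipC pG // mulrA -expr2 mulrC ler_wpM2r ?sqr_ge0 ?Gk //.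
have := ip_ge0 (fun x => (- k^-1) * p x + f x); rewrite ip_quadratic //.
rewrite -fp; move: pp; rewrite [ip p f]ipC => pp H.
have kk : 0 <= k^-1 ^+ 2 by rewrite sqr_ge0.
have := ler_wpM2l kk pp; rewrite [X in _ <= X](_ : _ = k^-1 * ip f p); last first.
  by field; rewrite gt_eqF.
rewrite sqrrN in H => H2.
have H3 : 0 <= ip f f - k^-1 * ip f p by lra.
have := mulr_ge0 (ltW k0) H3; rewrite mulrBr mulrA mulfV ?gt_eqF // mul1r.
by rewrite subr_ge0.
Qed.

End L2.

(** * Bounded functionals determined by their values on indicators *)

Section Density.
Import HBNNSimple.
Context d (X : measurableType d) (R : realType).
Variable mu : {measure set X -> \bar R}.
Implicit Types f g : X -> R.

Lemma L2_le f g : measurable_fun setT f -> g \in Lfun mu 2%:E ->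
  (forall x, `|f x| <= g x) -> f \in Lfun mu 2%:E.
Proof.
move=> mf /L2P[mg gy] fg; apply/L2P; split=> //; apply: le_lt_trans gy.
apply: ge0_le_integral => //.
- by move=> x _; rewrite lee_fin sqr_ge0.
- by apply/measurable_EFinP; exact: measurable_funX.
- by apply/measurable_EFinP; exact: measurable_funX.
- by move=> x _; rewrite lee_fin -[f x ^+ 2]real_normK ?num_real // ler_pXn2r ?nnegrE //
  (le_trans _ (fg x)).
Qed.

Lemma L2_indic (A : set X) : measurable A -> (mu A < +oo)%E ->
  (\1_A : X -> R) \in Lfun mu 2%:E.
Proof.
move=> mA Ay; apply/L2P; split; first exact: measurable_indic.
rewrite (eq_integral (fun x => (\1_A x)%:E)); first by rewrite integral_indic // setIT.
by move=> x _; rewrite indicE expr2 -natrM mulnb andbb.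
Qed.

Definition L2_functional (L : (X -> R) -> R) :=
  (forall a f g, f \in Lfun mu 2%:E -> g \in Lfun mu 2%:E ->
    L (fun x => a * f x + g x) = a * L f + L g) /\
  exists C : R, forall f, f \in Lfun mu 2%:E -> L f ^+ 2 <= C * ip mu f f.

Section functional.
Variable L : (X -> R) -> R.
Hypothesis LL : L2_functional L.

Lemma functional0 : L (fun=> 0) = 0.
Proof.
have := LL.1 (-1) _ _ (L20 mu) (L20 mu).
by under eq_fun do rewrite mulr0 addr0; rewrite mulN1r addNr.
Qed.

Lemma functional_sum (I : eqType) (s : seq I) (F : I -> X -> R) :
  (forall i, i \in s -> F i \in Lfun mu 2%:E) ->
  L (fun x => \sum_(i <- s) F i x) = \sum_(i <- s) L (F i).
Proof.
elim: s => [|i s IH] H.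
  by rewrite big_nil -[RHS]functional0; congr L; apply/funext => x; rewrite big_nil.
have Hs j : j \in s -> F j \in Lfun mu 2%:E by move=> js; rewrite H // inE js orbT.
rewrite big_cons -IH // -[L (F i)]mul1r -LL.1 ?H ?mem_head //; last exact: L2_sum.
by congr L; apply/funext => x; rewrite big_cons mul1r.
Qed.

Lemma functionalZ a f : f \in Lfun mu 2%:E -> L (fun x => a * f x) = a * L f.
Proof.
move=> fL; have := LL.1 a _ _ fL (L20 mu).
by under eq_fun do rewrite addr0; rewrite functional0 addr0.
Qed.

Lemma functionalB f g : f \in Lfun mu 2%:E -> g \in Lfun mu 2%:E ->
  L (fun x => f x - g x) = L f - L g.
Proof.
move=> fL gL; have := LL.1 (-1) _ _ gL fL.
by under eq_fun do rewrite mulN1r addrC; rewrite mulN1r addrC.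
Qed.

(** Dominated convergence of the squares (f - f_n)^2, bounded by 4 g^2, gives
    convergence in L^2, and L is continuous there. *)
Lemma functional_dominated (f_ : (X -> R)^nat) f g :
  (forall n, measurable_fun setT (f_ n)) -> measurable_fun setT f ->
  g \in Lfun mu 2%:E -> (forall n x, `|f_ n x| <= g x) ->
  (forall x, f_ n x @[n --> \oo] --> f x) ->
  (forall n, L (f_ n) = 0) -> L f = 0.
Proof.
move=> mf_ mf gL f_g f_f L0.
have fg x : `|f x| <= g x.
  have h : (fun n => `|f_ n x|) @ \oo --> `|f x| by apply: cvg_norm; exact: f_f.
  rewrite -(cvg_lim _ h) //; apply: limr_le; first by apply/cvg_ex; exists `|f x|.
  by near=> n; exact: f_g.
have fL : f \in Lfun mu 2%:E by exact: L2_le fg.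
have f_L n : f_ n \in Lfun mu 2%:E by exact: L2_le (f_g n).
have dL n := L2B fL (f_L n).
have [C LC] := LL.2.
have LfC n : L f ^+ 2 <= `|C| * ip mu (fun x => f x - f_ n x) (fun x => f x - f_ n x).
  have -> : L f = L (fun x => f x - f_ n x) by rewrite functionalB // L0 subr0.
  by apply: (le_trans (LC _ (dL n))); rewrite ler_wpM2r ?ip_ge0 ?ler_norm.
have ipE n : (ip mu (fun x => f x - f_ n x) (fun x => f x - f_ n x))%:E =
    (\int[mu]_x ((f x - f_ n x) ^+ 2)%:E)%E by rewrite ip_sqr.
have mF n : measurable_fun setT (fun x => ((f x - f_ n x) ^+ 2)%:E).
  by apply/measurable_EFinP/measurable_funX; exact: measurable_funB.
have m0 : measurable_fun setT (fun _ : X => 0%:E : \bar R) by exact: measurable_cst.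
have H0 : {ae mu, forall x, setT x ->
    ((f x - f_ n x) ^+ 2)%:E @[n --> \oo] --> (0%:E : \bar R)}.
  apply: aeW => x _; apply: cvg_EFin; first by near=> n.
  rewrite /comp /=.
  have : (fun n => (f x - f_ n x) * (f x - f_ n x)) @ \oo --> (f x - f x) * (f x - f x).
    by apply: cvgM; apply: cvgB => //; exact: cvg_cst.
  by rewrite subrr mulr0; under eq_fun do rewrite -expr2.
have Hg : {ae mu, forall x n, setT x -> (`|((f x -
  f_ n x) ^+ 2)%:E| <= (4 * g x * g x)%:E)%E}.
  apply: aeW => x n _; rewrite abse_EFin lee_fin ger0_norm ?sqr_ge0 //.
  rewrite -[leLHS]real_normK ?num_real //.
  have := ler_normB (f x) (f_ n x); have := fg x; have := f_g n x.
  move: (normr_ge0 (f x - f_ n x)); nra.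
have iG : mu.-integrable setT (fun x => (4 * g x * g x)%:E).
  exact: L2_integrableM (L2Z 4 gL) gL.
have [_ _] := dominated_convergence measurableT mF m0 H0 iG Hg.
rewrite integral0 => H.
have {}H : ip mu (fun x => f x - f_ n x) (fun x => f x - f_ n x) @[n --> \oo] --> (0 : R).
  apply: fine_cvg; apply: cvg_trans H; apply: near_eq_cvg; near=> n => /=.
  by apply: eq_integral => x _; rewrite expr2.
have : (fun n => `|C| * ip mu (fun x => f x - f_ n x) (fun x => f x -
  f_ n x)) @ \oo --> `|C| * 0.
  exact: cvgMr.
rewrite mulr0 => H2.
have : L f ^+ 2 <= 0.
  rewrite -(cvg_lim _ H2) //; apply: limr_ge; first by apply/cvg_ex; exists 0.
  by near=> n; exact: LfC.
by rewrite le_eqVlt ltNge sqr_ge0 orbF sqrf_eq0 => /eqP.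
Unshelve. all: by end_near.
Qed.

(** The measurable sets whose trace on E_n has an indicator killed by L form a
    Dynkin system, because L passes to dominated limits. So L vanishes on all simple
    functions supported in some E_n, and these approximate every nonnegative f in
    L^2 from below. *)
Lemma functional_eq0 (G : set (set X)) (E : (set X)^nat) :
  @measurable _ X = <<s G >> -> setI_closed G ->
  (forall n, measurable (E n)) -> (forall n, (mu (E n) < +oo)%E) ->
  (forall x, \forall n \near \oo, E n x) ->
  (forall n, L (\1_(E n)) = 0) ->
  (forall n A, G A -> L (\1_(A `&` E n)) = 0) ->
  forall f, f \in Lfun mu 2%:E -> L f = 0.
Proof.
move=> GE GI mE Ey Ex LE LG.
have EL n : (\1_(E n) : X -> R) \in Lfun mu 2%:E by exact: L2_indic.
have AEL n A : measurable A -> (\1_(A `&` E n) : X -> R) \in Lfun mu 2%:E.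
  move=> mA; have mAE : measurable (A `&` E n) by exact: measurableI.
  by apply: L2_indic => //; apply: le_lt_trans (Ey n); apply: le_measure; rewrite ?inE.
have Lind n A : measurable A -> L (\1_(A `&` E n)) = 0.
  rewrite GE; move: A; apply: dynkin_induction => //=.
  - by rewrite setTI.
  - exact: LG.
  - move=> A mA LA.
    have -> : \1_(~` A `&` E n) = (fun x => \1_(E n) x - \1_(A `&` E n) x) :> (X -> R).
      apply/funext => x; rewrite !indicE !in_setI in_setC.
      by case: (x \in A); case: (x \in E n); rewrite /= ?subrr ?subr0.
    by rewrite functionalB ?LE ?LA ?subr0 //; exact: AEL.
  - move=> F mF tF LF.
    have LS k : L (\1_((\big[setU/set0]_(i < k) F i) `&` E n)) = 0.
      elim: k => [|k IH].
        by rewrite big_ord0 set0I indic0 functional0.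
      have mS : measurable (\big[setU/set0]_(i < k) F i).
        by apply: bigsetU_measurable => i _.
      rewrite -[RHS](_ : 1 * L (\1_(F k `&` E n)) +
        L (\1_((\big[setU/set0]_(i < k) F i) `&` E n)) = 0);
        last by rewrite IH LF mulr0 addr0.
      rewrite -LL.1; [|exact: AEL|exact: AEL].
      congr L; apply/funext => x; rewrite big_ord_recr /= !indicE !in_setI in_setU mul1r.
      have [xk|xk] := boolP (x \in F k); last by rewrite orbF add0r.
      suff -> : (x \in \big[setU/set0]_(i < k) F i) = false by rewrite addr0.
      apply/negbTE; rewrite -(bigcup_mkord k F) notin_setE => -[i /= ik Fix].
      have := tF i k I I; move: xk; rewrite inE => Fkx.
      have /[swap] /[apply] : F i `&` F k !=set0 by exists x.
      by move=> ik'; rewrite ik' ltnn in ik.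
    apply: (functional_dominated _ _ (EL n) _ _ LS).
    + move=> k; apply: measurable_indic; apply: measurableI => //.
      by apply: bigsetU_measurable => i _.
    + by apply: measurable_indic; apply: measurableI => //; apply: bigcup_measurable.
    + move=> k x; rewrite !indicE in_setI ger0_norm // ler_nat.
      by case: (x \in _); case: (x \in E n).
    + move=> x; apply: cvg_near_cst.
      have [[k _ Fkx]|nF] := pselect ((\bigcup_k F k) x).
        near=> m; rewrite !indicE !in_setI.
        have -> : x \in \bigcup_k F k by apply/mem_set; exists k.
        have -> // : x \in \big[setU/set0]_(i < m) F i.
        rewrite -(bigcup_mkord m F); apply/mem_set; exists k => //=.
        by near: m; exact: nbhs_infty_gt.
      near=> m; rewrite !indicE !in_setI (memNset nF).
      have -> // : (x \in \big[setU/set0]_(i < m) F i) = false.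
      apply/memNset; rewrite -(bigcup_mkord m F) => -[k /= _ Fkx].
      by apply: nF; exists k.
have Lpos f : f \in Lfun mu 2%:E -> (forall x, 0 <= f x) -> L f = 0.
  move=> fL f0.
  have mf : measurable_fun setT (EFin \o f) by apply/measurable_EFinP;
    exact: L2_measurable fL.
  pose s n := nnsfun_approx measurableT mf n.
  have sE n x : s n x * \1_(E n) x =
     \sum_(y <- finmap.enum_fset (fset_set (range (s n)))) y * \1_(s n @^-1` [set y] `&`
       E n) x.
    rewrite fimfunE fsbig_finite //= mulr_suml; apply: eq_bigr => y _.
    by rewrite -mulrA indicI.
  have sf n x : s n x <= f x.
    rewrite -lee_fin /s nnsfun_approxE.
    by apply: (le_approx (f := EFin \o f)) => // y _; rewrite lee_fin.
  apply: (functional_dominated (f_ := fun n x => s n x * \1_(E n) x) _ _ fL).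
  - by move=> n; apply: measurable_funM => //; exact: measurable_indic.
  - exact/measurable_EFinP.
  - move=> n x; rewrite normrM ger0_norm ?ger0_norm //.
    by rewrite indicE; case: (x \in E n); rewrite ?mulr1 ?mulr0 ?f0 ?sf.
  - move=> x.
    have H : EFin \o s^~ x @ \oo --> (f x)%:E by apply: cvg_nnsfun_approx => // y _;
      rewrite lee_fin.
    have {}H : s^~ x @ \oo --> f x by exact: (fine_cvg H).
    apply: cvg_trans H; apply: near_eq_cvg.
    near=> n; rewrite indicE mem_set ?mulr1 //.
    by near: n; exact: Ex.
  - move=> n; have -> : (fun x => s n x * \1_(E n) x) = (fun x =>
       \sum_(y <- finmap.enum_fset (fset_set (range (s n)))) y * \1_(s n @^-1` [set y]
         `&` E n) x).
      by apply/funext => x; exact: sE.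
    rewrite functional_sum => [|y _]; last by apply: L2Z; exact: AEL.
    by rewrite big1 // => y _; rewrite functionalZ ?Lind ?mulr0 //; exact: AEL.
move=> f fL.
have aL : (fun x => `|f x|) \in Lfun mu 2%:E.
  have /L2P[mf fy] := fL; apply/L2P; split; first exact: measurableT_comp.
  by under eq_integral do rewrite real_normK ?num_real //.
have -> : f = (fun x => 2^-1 * (`|f x| + f x) - 2^-1 * (`|f x| - f x)).
  by apply/funext => x; field.
rewrite functionalB; [|exact/L2Z/L2D|exact/L2Z/L2B].
rewrite !Lpos ?subr0 //; [exact/L2Z/L2B| |exact/L2Z/L2D|] => x.
  by rewrite mulr_ge0 // subr_ge0 ler_norm.
by rewrite mulr_ge0 // -lerBlDr sub0r -normrN ler_norm.
Unshelve. all: by end_near.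
Qed.

End functional.
End Density.

(** * Dyadic intervals and pointwise products of Haar functions *)

Section DyadicGrid.
Context {R : realType}.
Implicit Types (I A B : dyadic) (x : R).

(** The position of the point among the dyadic intervals of length 2^n: membership
    in dyadic intervals becomes an equation between integers. *)
Definition dindex (n : int) x : int := Num.floor (x / 2 ^ n).

Lemma dyadic_length_gt0 I : 0 < dyadic_length I :> R.
Proof. exact: exprz_gt0. Qed.

Lemma dyadic_intervalE I x : dyadic_interval I x <-> dindex I.1 x = I.2.
Proof.
have I0 := dyadic_length_gt0 I.
rewrite /dyadic_interval /= in_itv /= -ler_pdivlMr // -ltr_pdivrMr //.
rewrite -floor_eq; split; first by move/eqP.
by move=> /eqP.
Qed.

Lemma indic_dyadic I x : \1_(dyadic_interval I) x = (dindex I.1 x == I.2)%:R :> R.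
Proof.
rewrite indicE; congr (_%:R); congr nat_of_bool.
by apply/idP/eqP => [/set_mem/dyadic_intervalE //|?]; apply/mem_set/dyadic_intervalE.
Qed.

Lemma dindex_coarsen n (m : nat) x :
  dindex (n + m%:Z) x = (dindex n x %/ 2 ^+ m)%Z.
Proof.
rewrite /dindex; apply: floor_def.
set k := Num.floor _; have /andP[k1 k2] : k%:~R <= x / 2 ^ n < (k +
  1)%:~R by exact: floor_itv.
have p0 : (0 : int) < 2 ^+ m by rewrite exprn_gt0.
have pR : (0 : R) < 2 ^+ m by rewrite exprn_gt0.
rewrite expfzDr // invfM mulrA -exprnP ler_pdivlMr // ltr_pdivrMr //.
have E : (2 ^+ m : R) = (2 ^+ m : int)%:~R by rewrite rmorphXn.
rewrite E -!intrM; apply/andP; split.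
  by apply: le_trans k1; rewrite ler_int lez_floor // gt_eqF.
apply: (lt_le_trans k2); rewrite ler_int lezD1.
exact: ltz_ceil.
Qed.

Lemma dyadic_length_left I : dyadic_length (dyadic_left I) = dyadic_length I / 2 :> R.
Proof. by rewrite /dyadic_length /= expfzDr // exprN1. Qed.

Lemma dyadic_length_right I : dyadic_length (dyadic_right I) = dyadic_length I / 2 :> R.
Proof. by rewrite /dyadic_length /= expfzDr // exprN1. Qed.

Lemma indic_halves I x : \1_(dyadic_interval I) x =
  \1_(dyadic_interval (dyadic_left I)) x + \1_(dyadic_interval (dyadic_right I)) x :> R.
Proof.
rewrite !indic_dyadic /=.
have -> : dindex I.1 x = (dindex (I.1 - 1) x %/ 2)%Z.
  by rewrite -(dindex_coarsen _ 1) subrK.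
move: (dindex _ _) => k; rewrite -natrD; congr (_%:R); lia.
Qed.

Lemma indic_leftM_right I x : \1_(dyadic_interval (dyadic_left I)) x *
  \1_(dyadic_interval (dyadic_right I)) x = 0 :> R.
Proof.
rewrite !indic_dyadic /= -natrM mulnb; move: (dindex _ _) => k.
by have -> : (k == 2 * I.2) && (k == 2 * I.2 + 1) = false by lia.
Qed.

(** Two dyadic intervals are nested or disjoint; [e] tells which. *)
Lemma indicM_dyadic A B : A.1 <= B.1 -> exists e : bool, forall x,
  \1_(dyadic_interval A) x * \1_(dyadic_interval B) x =
  e%:R * \1_(dyadic_interval A) x :> R.
Proof.
move=> AB; have [m Bm] : exists m : nat, B.1 = A.1 + m%:Z.
  by exists `|B.1 - A.1|%N; lia.
exists ((A.2 %/ 2 ^+ m)%Z == B.2) => x.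
rewrite !indic_dyadic Bm dindex_coarsen.
by have [->|_] := eqVneq (dindex A.1 x) A.2; rewrite ?mul0r ?mulr0 ?mul1r ?mulr1.
Qed.

Lemma indicM_same_length A B x : A.1 = B.1 -> A != B ->
  \1_(dyadic_interval A) x * \1_(dyadic_interval B) x = 0 :> R.
Proof.
case: A B => [n k] [n' l] /= <-; rewrite xpair_eqE eqxx /= => kl.
rewrite !indic_dyadic /=.
have [->|_] := eqVneq (dindex n x) k; last by rewrite mul0r.
by rewrite (negbTE kl) mulr0.
Qed.

Lemma indic_idem (D : set R) x : \1_D x * \1_D x = \1_D x :> R.
Proof. by rewrite indicE -natrM mulnb andbb. Qed.

Lemma haarM_indic I x : haar I x * \1_(dyadic_interval I) x = haar I x.
Proof.
rewrite /haar (indic_halves I) -mulrA; congr (_ * _).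
have := indic_leftM_right I x; set l := \1__ x; set r := \1__ x => lr.
have -> : (r - l) * (l + r) = r * r - l * l by ring.
by rewrite !indic_idem.
Qed.

Lemma haar_sqr I x :
  haar I x * haar I x = (dyadic_length I)^-1 * \1_(dyadic_interval I) x.
Proof.
rewrite /haar (indic_halves I) mulrACA -invfM -expr2 sqr_sqrtr ?ltW ?dyadic_length_gt0 //.
congr (_ * _); have := indic_leftM_right I x; set l := \1__ x; set r := \1__ x => lr.
have -> : (r - l) * (r - l) = r * r + l * l - 2 * (l * r) by ring.
by rewrite lr !indic_idem mulr0 subr0 addrC.
Qed.

(** A dyadic interval shorter than B lies in one half of B or misses B. *)
Lemma haar_cst A B : A.1 < B.1 -> exists c, forall x,
  \1_(dyadic_interval A) x * haar B x = c * \1_(dyadic_interval A) x.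
Proof.
move=> AB.
have [|e1 H1] := @indicM_dyadic A (dyadic_right B); first by rewrite /=; lia.
have [|e2 H2] := @indicM_dyadic A (dyadic_left B); first by rewrite /=; lia.
exists ((Num.sqrt (dyadic_length B))^-1 * (e1%:R - e2%:R)) => x.
by rewrite /haar mulrCA mulrBr H1 H2 -mulrBl mulrA.
Qed.

Lemma haarM_le A B : A != B -> A.1 <= B.1 -> exists c, forall x,
  haar A x * haar B x = c * haar A x.
Proof.
rewrite le_eqVlt => AB /predU1P[E|lt]; last first.
  have [c H] := haar_cst lt; exists c => x.
  by rewrite -[in LHS]haarM_indic -mulrA H mulrC -mulrA [X in c * X]mulrC haarM_indic.
exists 0 => x; rewrite mul0r -[haar A x]haarM_indic -[haar B x]haarM_indic.
by rewrite mulrACA indicM_same_length // mulr0.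
Qed.

(** The Haar function of the longer interval is constant on the shorter one, and
    distinct intervals of equal length are disjoint. *)
Lemma haarM A B : A != B -> exists c, forall x,
  haar A x * haar B x = c * haar (if A.1 <= B.1 then A else B) x.
Proof.
move=> AB; case: leP => [|/ltW] H; first exact: haarM_le.
have [|c E] := @haarM_le B A _ H; first by rewrite eq_sym.
by exists c => x; rewrite mulrC E.
Qed.

Lemma dyadic_evenP I : dyadic_even R I <-> (2 %| I.1)%Z.
Proof.
split=> [[k E]|/dvdzP[k E]].
  have {}E : I.1 = - (2 * k).
    by apply: (@ieexprIz R 2) E => //; rewrite gt_eqF // ltr1n.
  by rewrite E dvdzE abszN abszM dvdn_mulr.
by exists (- k); rewrite /dyadic_length E; congr (_ ^ _); ring.
Qed.

End DyadicGrid.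

(** * Inner products of Haar functions and of tensors *)

Section Integrals.
Context {R : realType}.
Implicit Types (I A B : dyadic) (x : R).
Local Notation le1 := (@lebesgue_measure R).
Local Notation le2 := (@lebesgue2 R).

Lemma measurable_dyadic I : measurable (dyadic_interval I : set (measurableTypeR R)).
Proof. exact: measurable_itv. Qed.

Lemma lebesgue_dyadic I : le1 (dyadic_interval I) = (dyadic_length I)%:E.
Proof.
rewrite /dyadic_interval lebesgue_measure_itv /= lte_fin.
have I0 := @dyadic_length_gt0 R I.
rewrite ltr_pM2r // ltr_int ltzD1 lexx -EFinB.
by rewrite -mulrBl -rmorphB /= addrAC subrr add0r mul1r.
Qed.

Lemma L2_dyadic I : (\1_(dyadic_interval I) : R -> R) \in Lfun le1 2%:E.
Proof.
apply: L2_indic; first exact: measurable_dyadic.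
by rewrite [X in (X < _)%E]lebesgue_dyadic ltry.
Qed.

Lemma L2_haar I : (haar I : R -> R) \in Lfun le1 2%:E.
Proof. by apply: L2Z; apply: L2B; exact: L2_dyadic. Qed.

Lemma ip_indic_same I : ip le1 \1_(dyadic_interval I) \1_(dyadic_interval I) =
  dyadic_length I.
Proof.
rewrite /ip /Rintegral; under eq_integral do rewrite indic_idem.
rewrite integral_indic //; last exact: measurable_dyadic.
by rewrite setIT [X in fine X]lebesgue_dyadic.
Qed.

Lemma ip_haar_indic A B : A.1 <= B.1 -> ip le1 (haar A) \1_(dyadic_interval B) = 0.
Proof.
move=> AB; have [e E] := @indicM_dyadic R _ _ AB.
transitivity (e%:R * ip le1 (haar A) \1_(dyadic_interval A)).
  rewrite -ipZl ?L2_haar ?L2_dyadic //; apply: eq_Rintegral => x _.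
  by rewrite -[haar A x in LHS]haarM_indic -(mulrA (haar A x)) E; ring.
rewrite /haar ipZl ?L2_dyadic //; last by apply: L2B; exact: L2_dyadic.
rewrite ipBl ?L2_dyadic //.
have H C : dyadic_length C = dyadic_length A / 2 :> R ->
    (forall x, \1_(dyadic_interval C) x * \1_(dyadic_interval A) x =
      \1_(dyadic_interval C) x :> R) ->
    ip le1 \1_(dyadic_interval C) \1_(dyadic_interval A) = dyadic_length A / 2.
  move=> CA HC; rewrite -CA -ip_indic_same; apply: eq_Rintegral => x _.
  by rewrite HC indic_idem.
rewrite !H ?subrr ?mulr0 ?dyadic_length_left ?dyadic_length_right // => x;
  rewrite (indic_halves A) mulrDr indic_idem.
  by rewrite indic_leftM_right addr0.
by rewrite mulrC indic_leftM_right add0r.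
Qed.

Lemma ip_haar A B : ip le1 (haar A) (haar B) = (A == B)%:R.
Proof.
have [<-|AB] := eqVneq A B.
  transitivity ((dyadic_length A)^-1 * ip le1 \1_(dyadic_interval A) \1_(dyadic_interval
    A)).
    rewrite -ipZl ?L2_dyadic //; apply: eq_Rintegral => x _.
    by rewrite haar_sqr -mulrA indic_idem.
  by rewrite ip_indic_same mulVf // gt_eqF // dyadic_length_gt0.
wlog AleB : A B AB / A.1 <= B.1.
  move=> H; have [|/ltW] := leP A.1 B.1; first exact: H.
  by rewrite ipC; apply: H; rewrite eq_sym.
have [c H] := @haarM_le R _ _ AB AleB.
transitivity (c * ip le1 (haar A) \1_(dyadic_interval A));
  last by rewrite ip_haar_indic // mulr0.
rewrite -ipZl ?L2_dyadic ?L2_haar //; apply: eq_Rintegral => x _.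
by rewrite H -mulrA haarM_indic.
Qed.

(** The function that the dyadic shift sends the Haar function of I to. *)
Definition haar_shift I : R -> R :=
  if (2 %| I.1)%Z then fun x => haar (dyadic_right I) x - haar (dyadic_left I) x
  else fun=> 0.

Lemma L2_haar_shift I : (haar_shift I : R -> R) \in Lfun le1 2%:E.
Proof.
rewrite /haar_shift; case: ifP => _; last exact: L20.
by apply: L2B; exact: L2_haar.
Qed.

Lemma dyadic_right_inj : injective dyadic_right.
Proof. by move=> [n k] [m l] [/addIr -> /eqP]; rewrite -subr_eq0 => H; congr pair; lia. Qed.

Lemma dyadic_left_inj : injective dyadic_left.
Proof. by move=> [n k] [m l] [/addIr -> /eqP]; rewrite -subr_eq0 => H; congr pair; lia. Qed.

Lemma dyadic_right_neq_left A B : dyadic_right A != dyadic_left B.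
Proof. by rewrite xpair_eqE /=; lia. Qed.

(** The children of distinct intervals are distinct, and a right half is never a
    left half, so only the diagonal terms survive. *)
Lemma ip_haar_shift A B : ip le1 (haar_shift A) (haar_shift B) =
  if (2 %| A.1)%Z then 2 * (A == B)%:R else 0.
Proof.
rewrite /haar_shift; case: ifPn => eA; last by rewrite ip0l.
case: ifPn => eB; last first.
  rewrite ipC ip0l; have [AB|] := eqVneq A B; last by rewrite mulr0.
  by rewrite AB (negbTE eB) in eA.
rewrite ipBl; [|exact: L2_haar|exact: L2_haar|by apply: L2B; exact: L2_haar].
rewrite ipC ipBl ?L2_haar // [X in _ - X]ipC ipBl ?L2_haar // !ip_haar.
rewrite (inj_eq dyadic_right_inj) (inj_eq dyadic_left_inj) (negbTE (dyadic_right_neq_left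
  _ _)).
rewrite [dyadic_left _ == _]eq_sym (negbTE (dyadic_right_neq_left _ _)) eq_sym.
by rewrite !mulr0n; ring.
Qed.

Lemma integral_tensor (p q : R -> R) : le1.-integrable setT (EFin \o p) ->
  le1.-integrable setT (EFin \o q) ->
  le2.-integrable setT (EFin \o tensor p q) /\
  (\int[le2]_z tensor p q z = (\int[le1]_x p x) * (\int[le1]_y q y))%R.
Proof.
move=> ip iq.
have mp : measurable_fun setT p by apply/measurable_EFinP; exact: measurable_int ip.
have mq : measurable_fun setT q by apply/measurable_EFinP; exact: measurable_int iq.
have mT : measurable_fun setT (EFin \o tensor p q).
  apply/measurable_EFinP; apply: measurable_funM.
    exact: measurableT_comp mp measurable_fst.
  exact: measurableT_comp mq measurable_snd.
have aq : (\int[le1]_y `|(q y)%:E| < +oo)%E by case/integrableP: iq.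
have iT : le2.-integrable setT (EFin \o tensor p q).
  apply/integrable12ltyP => //=.
  have E x : (\int[le1]_y `|tensor p q (x, y)|%:E =
      `|p x|%:E * (\int[le1]_y `|(q y)%:E|))%E.
    rewrite -ge0_integralZl //; last first.
      by apply: measurableT_comp => //; exact/measurable_EFinP.
    by apply: eq_integral => y _; rewrite /tensor /= -EFinM normrM.
  under eq_integral do rewrite E.
  rewrite ge0_integralZr //; last 2 first.
  - by apply/measurable_EFinP; exact: measurableT_comp.
  - exact: integral_ge0.
  apply: lte_mul_pinfty => //; first exact: integral_ge0.
  rewrite ge0_fin_numE ?integral_ge0 //.
  by case/integrableP: ip.
split=> //; rewrite /Rintegral -integral12_prod_meas1 //=.
have E x : (\int[le1]_y (tensor p q (x, y))%:E = (p x)%:E * (\int[le1]_y (q y)%:E))%E.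
  by rewrite -integralZl.
under eq_integral do rewrite /fubini_F /= E.
rewrite -[(\int[le1]_y (q y)%:E)%E]fineK ?(integrable_fin_num _ iq) //.
by rewrite integralZr //= fineM // (integrable_fin_num _ ip).
Qed.

Lemma L2_tensor (f g : R -> R) : f \in Lfun le1 2%:E -> g \in Lfun le1 2%:E ->
  tensor f g \in Lfun le2 2%:E.
Proof.
move=> fL gL; apply/L2P; split.
  apply: measurable_funM.
    exact: measurableT_comp (L2_measurable fL) measurable_fst.
  exact: measurableT_comp (L2_measurable gL) measurable_snd.
have [H _] := integral_tensor (L2_integrableM fL fL) (L2_integrableM gL gL).
have /integrableP[_] := H; apply: le_lt_trans.
rewrite le_eqVlt; apply/orP; left; apply/eqP; apply: eq_integral => z _ /=.
rewrite /tensor ger0_norm; last by rewrite mulr_ge0 // -expr2 sqr_ge0.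
by rewrite expr2 mulrACA.
Qed.

Lemma ip_tensor (f g f' g' : R -> R) :
  f \in Lfun le1 2%:E -> g \in Lfun le1 2%:E ->
  f' \in Lfun le1 2%:E -> g' \in Lfun le1 2%:E ->
  ip le2 (tensor f g) (tensor f' g') = ip le1 f f' * ip le1 g g'.
Proof.
move=> fL gL f'L g'L.
have [_ <-] := integral_tensor (L2_integrableM fL f'L) (L2_integrableM gL g'L).
by apply: eq_Rintegral => z _; rewrite /tensor mulrACA.
Qed.

Lemma tensor_ael (f f' g : R -> R) : f = f' %[ae le1] -> tensor f g = tensor f' g %[ae le2].
Proof.
move=> [N [mN N0 Nsub]]; exists (N `*` setT); split.
- exact: measurableX.
- transitivity (le1 N * le1 setT)%E; first exact: product_measure1E.
  by rewrite [X in (X * _)%E]N0 mul0e.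
- move=> [x y] /= H; split=> //=; apply: Nsub => /= fx; apply: H => _.
  by rewrite /tensor /= fx.
Qed.

Lemma tensor_aer (f g g' : R -> R) : g = g' %[ae le1] -> tensor f g = tensor f g' %[ae le2].
Proof.
move=> [N [mN N0 Nsub]]; exists (setT `*` N); split.
- exact: measurableX.
- transitivity (le1 setT * le1 N)%E; first exact: product_measure1E.
  by rewrite [X in (_ * X)%E]N0 mule0.
- move=> [x y] /= H; split=> //=; apply: Nsub => /= fx; apply: H => _.
  by rewrite /tensor /= fx.
Qed.

End Integrals.

(** * Completeness of the Haar system *)

Section Completeness.
Context {R : realType}.
Implicit Types (I A B : dyadic) (x : R).
Local Notation le1 := (@lebesgue_measure R).
Local Notation le2 := (@lebesgue2 R).

(** The pi-system property of dyadic intervals; it also drives the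
    inclusion-exclusion for unions of dyadic rectangles. *)
Lemma dyadic_setI A B :
  [\/ dyadic_interval A `&` dyadic_interval B = set0 :> set R,
      dyadic_interval A `&` dyadic_interval B = dyadic_interval A :> set R |
      dyadic_interval A `&` dyadic_interval B = dyadic_interval B :> set R].
Proof.
wlog AB : A B / A.1 <= B.1.
  move=> H; have [|/ltW] := leP A.1 B.1; [exact: H|rewrite setIC => /H].
  by case; [constructor 1|constructor 3|constructor 2].
have [e E] := @indicM_dyadic R _ _ AB.
have {}E x : ((x \in dyadic_interval A) && (x \in dyadic_interval B)) =
  e && (x \in dyadic_interval A).
  have := E x; rewrite !indicE -!natrM !mulnb => /eqP; rewrite eqr_nat.
  by do 2 case: (_ && _).
case: e E => E; [constructor 2|constructor 1]; apply/seteqP; split => x //=.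
- by case.
- move=> Ax; split=> //; have := E x; rewrite (mem_set Ax) /= => Bx; exact: set_mem.
- by move=> [Ax Bx]; have := E x; rewrite !mem_set.
Qed.

Definition dyadic_sets : set (set R) :=
  [set D | D = set0 \/ exists A, D = dyadic_interval A].

Lemma dyadic_sets_setI : setI_closed dyadic_sets.
Proof.
move=> D E [->|[A ->]]; first by rewrite set0I; left.
move=> [->|[B ->]]; first by rewrite setI0; left.
by have [->|->|->] := dyadic_setI A B; [left|right; exists A|right; exists B].
Qed.

Lemma dindex_expn_small x : exists n : nat, `|x| < 2 ^+ n.
Proof.
exists (Num.trunc `|x|).+1.
apply: lt_trans (truncnS_gt _) _; rewrite -natrX ltr_nat.
exact: ltn_expl.
Qed.

(** An open half-line is the union of the countably many dyadic intervals that it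
    contains. *)
Lemma measurable_dyadic_sets : @measurable _ (measurableTypeR R) = <<s dyadic_sets >>.
Proof.
apply/seteqP; split; last first.
  apply: smallest_sub; first exact: sigma_algebra_measurable.
  by move=> D [->|[A ->]]; [exact: measurable0|exact: measurable_dyadic].
rewrite [X in X `<=` _]RGenInftyO.measurableE.
apply: smallest_sub; first exact: smallest_sigma_algebra.
move=> D [x ->].
have -> : `]-oo, x[%classic = \bigcup_(A in [set A | dyadic_interval A `<=` `]-oo,
  x[%classic]) dyadic_interval A.
  apply/seteqP; split=> [y|y [A Ax /Ax]] //=; rewrite in_itv /= => yx.
  have [n xyn] := dindex_expn_small (x - y)^-1.
  have yx0 : 0 < x - y by rewrite subr_gt0.
  exists (- n%:Z, dindex (- n%:Z) y); last exact/dyadic_intervalE.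
  move=> z /dyadic_intervalE /= zy; rewrite /= in_itv /=.
  move: xyn; rewrite gtr0_norm ?invr_gt0 // invf_plt ?posrE ?exprn_gt0 // => xyn.
  have e0 : (0 : R) < 2 ^ (- n%:Z) by exact: exprz_gt0.
  have := floor_itv (y / 2 ^ (- n%:Z)); have := floor_itv (z / 2 ^ (- n%:Z)).
  rewrite -/(dindex _ _) -/(dindex _ y) zy => /andP[_ z2] /andP[y1 _].
  move: z2 y1; rewrite ltr_pdivrMr // ler_pdivlMr // => z2 y1.
  rewrite -exprnN in z2 y1.
  have -> : x = y + (x - y) by ring.
  apply: (lt_le_trans z2); rewrite rmorphD /= mulrDl mul1r lerD // ltW //.
rewrite bigcup_mkcond; apply: (@countable_bigcupT_measurable _ (g_sigma_algebraType
  dyadic_sets)).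
  exact: countableP.
move=> A; case: ifP => _; last exact: measurable0.
by apply: sub_sigma_algebra; right; exists A.
Qed.

Definition dyadic_parent A : dyadic := (A.1 + 1, (A.2 %/ 2)%Z).

(** The indicator of a half of P is (1_P + r) / 2 or (1_P - r) / 2, where
    r = |P|^(1/2) h_P takes the values 1 and -1 on the halves of P. *)
Lemma indic_child A : exists c : R, forall x, \1_(dyadic_interval A) x =
  2^-1 * \1_(dyadic_interval (dyadic_parent A)) x + c * haar (dyadic_parent A) x :> R.
Proof.
set P := dyadic_parent A.
have s0 : Num.sqrt (dyadic_length P) != 0 :> R.
  by rewrite gt_eqF // sqrtr_gt0 dyadic_length_gt0.
have H c x : (2^-1 * c * Num.sqrt (dyadic_length P)) * haar P x =
    2^-1 * c * (\1_(dyadic_interval (dyadic_right P)) x -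
      \1_(dyadic_interval (dyadic_left P)) x) :> R.
  by rewrite /haar mulrA mulfK.
have [AE|AO] : A = dyadic_left P \/ A = dyadic_right P.
  rewrite /dyadic_left /dyadic_right /P /= addrK; case: (A) => n k /=.
  by have [E|E] : k = 2 * (k %/ 2)%Z \/ k = 2 * (k %/ 2)%Z + 1; [lia|left|right];
    rewrite -E.
- exists (2^-1 * (-1) * Num.sqrt (dyadic_length P)) => x.
  by rewrite H {1}AE (indic_halves P); field.
- exists (2^-1 * 1 * Num.sqrt (dyadic_length P)) => x.
  by rewrite H {1}AO (indic_halves P); field.
Qed.

(** Passing m times to the parent gives L 1_A = 2^-m L 1_P with |P| = 2^m |A|, and
    the squared norm of 2^-m 1_P is 2^-m |A|, which tends to 0. *)
Lemma functional_dyadic (L : (R -> R) -> R) : L2_functional le1 L ->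
  (forall A, L (haar A) = 0) -> forall A, L \1_(dyadic_interval A) = 0.
Proof.
move=> LL Lh A; have [C LC] := LL.2.
have H (m : nat) : exists2 P, P.1 = A.1 + m%:Z & L \1_(dyadic_interval A) =
  2 ^- m * L \1_(dyadic_interval P).
  elim: m => [|m [P Pm ->]]; first by exists A; rewrite ?addr0 // invr1 mul1r.
  have [c PQ] := indic_child P; set Q := dyadic_parent P in PQ.
  exists Q; first by rewrite /= Pm; lia.
  rewrite (_ : \1_(dyadic_interval P) = fun x => 2^-1 * \1_(dyadic_interval Q) x +
    c * haar Q x); last exact/funext.
  rewrite LL.1 ?L2_dyadic //; last by apply: L2Z; exact: L2_haar.
  rewrite (functionalZ LL) ?L2_haar // Lh mulr0 addr0 mulrA; congr (_ * _).
  by rewrite exprSr invfM.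
have B (m : nat) : L \1_(dyadic_interval A) ^+ 2 * 2 ^+ m <= `|C| * dyadic_length A.
  have [P P1 ->] := H m; rewrite exprMn.
  have := LC _ (L2_dyadic P); rewrite ip_indic_same => LP.
  have p0 : (0 : R) < 2 ^+ m by rewrite exprn_gt0.
  have -> : (2 ^- m : R) ^+ 2 * L \1_(dyadic_interval P) ^+ 2 * 2 ^+ m =
    2 ^- m * L \1_(dyadic_interval P) ^+ 2.
    by field; rewrite gt_eqF.
  have -> : dyadic_length A = 2 ^- m * dyadic_length P :> R.
    by rewrite /dyadic_length P1 expfzDr // -exprnP; field; rewrite gt_eqF.
  rewrite [leRHS]mulrCA ler_wpM2l ?invr_ge0 ?(ltW p0) //.
  by apply: (le_trans LP); rewrite ler_wpM2r ?ler_norm ?(ltW (dyadic_length_gt0 _)).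
apply/eqP; rewrite -sqrf_eq0 -[_ == _]negbK; apply/negP => L0.
have {}L0 : 0 < L \1_(dyadic_interval A) ^+ 2 by rewrite lt_def L0 sqr_ge0.
have [n] := dindex_expn_small (`|C| * dyadic_length A / L \1_(dyadic_interval A) ^+ 2).
rewrite ger0_norm; last first.
  by apply: divr_ge0; rewrite ?sqr_ge0 // mulr_ge0 // ltW // dyadic_length_gt0.
by rewrite ltr_pdivrMr // [ltRHS]mulrC ltNge B.
Qed.

(** A functional that kills the Haar functions kills the indicators of dyadic
    intervals, which are a pi-system generating the Borel sets; the exhausting
    sequence is made of the intervals from -2^n to 2^n. *)
Lemma haar_complete (L : (R -> R) -> R) : L2_functional le1 L ->
  (forall A, L (haar A) = 0) -> forall f, f \in Lfun le1 2%:E -> L f = 0.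
Proof.
move=> LL Lh; have LA := functional_dyadic LL Lh.
pose E (n : nat) : set R := dyadic_interval (n%:Z, -1) `|` dyadic_interval (n%:Z, 0).
have LD D : dyadic_sets D -> L \1_D = 0.
  by move=> [->|[A ->]]; rewrite ?indic0 ?(functional0 LL).
have L2D' D : dyadic_sets D -> (\1_D : R -> R) \in Lfun le1 2%:E.
  by move=> [->|[A ->]]; rewrite ?L2_dyadic // indic0; exact: L20.
have EE n D : \1_(D `&` E n) = (fun x => 1 * \1_(D `&` dyadic_interval (n%:Z, -1)) x +
    \1_(D `&` dyadic_interval (n%:Z, 0)) x) :> (R -> R).
  apply/funext => x; rewrite mul1r /E setIUr.
  have AB : (n%:Z, -1) != (n%:Z, 0) :> dyadic by rewrite xpair_eqE andbF.
  have := @indicM_same_length R (n%:Z, -1) (n%:Z, 0) x erefl AB.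
  rewrite !indicE in_setU !in_setI.
  by case: (x \in D); case: (_ \in _); case: (_ \in _);
    rewrite /= ?mulr1 ?addr0 ?add0r //= => /eqP; rewrite oner_eq0.
apply: (functional_eq0 (E := E) LL measurable_dyadic_sets dyadic_sets_setI).
- by move=> n; apply: measurableU; exact: measurable_dyadic.
- move=> n; apply: le_lt_trans (measureU2 _ _ _) _; try exact: measurable_dyadic.
  by rewrite [X in (X + _ < _)%E]lebesgue_dyadic [X in (_ +
    X < _)%E]lebesgue_dyadic -EFinD ltry.
- move=> x; have [n xn] := dindex_expn_small x; near=> m.
  have {}xn : `|x| < 2 ^+ m.
    by apply: (lt_le_trans xn); rewrite ler_eXn2l ?ltr1n //; near: m; exact: nbhs_infty_ge.
  have p0 : (0 : R) < 2 ^+ m by rewrite exprn_gt0.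
  move: xn; rewrite ltr_norml => /andP[x1 x2].
  have [x0|x0] := leP 0 x; [right|left]; apply/dyadic_intervalE; apply: floor_def => /=.
    by rewrite -exprnP ler_pdivlMr // ltr_pdivrMr // mul0r add0r mul1r x0.
  by rewrite -exprnP ler_pdivlMr // ltr_pdivrMr // addNr mul0r mulN1r x0 ltW.
- move=> n; have mA : dyadic_sets (dyadic_interval (n%:Z, -1)) by right; eexists.
  have mB : dyadic_sets (dyadic_interval (n%:Z, 0)) by right; eexists.
  by rewrite -[E n]setTI EE !setTI LL.1 ?LD ?mulr0 ?addr0 ?L2D'.
- move=> n D GD.
  have G1 : dyadic_sets (D `&` dyadic_interval (n%:Z, -1)).
    by apply: dyadic_sets_setI => //; right; eexists.
  have G2 : dyadic_sets (D `&` dyadic_interval (n%:Z, 0)).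
    by apply: dyadic_sets_setI => //; right; eexists.
  by rewrite EE LL.1 ?LD ?mulr0 ?addr0 ?L2D'.
Unshelve. all: by end_near.
Qed.

(** The measurable rectangles are a pi-system generating the product sigma-algebra,
    and their indicators are tensors. *)
Lemma tensor_complete (L : (R * R -> R) -> R) : L2_functional le2 L ->
  (forall f g, f \in Lfun le1 2%:E -> g \in Lfun le1 2%:E -> L (tensor f g) = 0) ->
  forall f, f \in Lfun le2 2%:E -> L f = 0.
Proof.
move=> LL Lt.
pose J (n : nat) : set (measurableTypeR R) := `[- n%:R, n%:R]%classic.
have mJ n : measurable (J n) by exact: measurable_itv.
have Jy n : (le1 (J n) < +oo)%E.
  rewrite /J lebesgue_measure_itv /=; case: ifP => _ //; exact: ltry.
have JL n (D : set (measurableTypeR R)) : measurable D ->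
    (\1_(D `&` J n) : R -> R) \in Lfun le1 2%:E.
  move=> mD; have mDJ : measurable (D `&` J n) by exact: measurableI.
  by apply: L2_indic => //; apply: le_lt_trans (Jy n); apply: le_measure; rewrite ?inE.
have IT (A B : set R) : \1_(A `*` B) = tensor \1_A \1_B :> (R * R -> R).
  by apply/funext => -[x y]; rewrite /tensor /= !indicE in_setX -natrM mulnb.
apply: (functional_eq0 (E := fun n => J n `*` J n) LL (measurable_prod_measurableType _ _)).
- by move=> _ _ [A mA [B mB <-]] [C mC [D mD <-]]; exists (A `&` C);
  [exact: measurableI|exists (B `&` D); [exact: measurableI|rewrite setXI]].
- by move=> n; exact: measurableX.
- move=> n; rewrite (_ : le2 _ = le1 (J n) * le1 (J n))%E; last exact: product_measure1E.
  by rewrite lte_mul_pinfty // ge0_fin_numE.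
- move=> [x y]; near=> n; split; rewrite /J /= in_itv /= -ler_norml.
    by near: n; exact: nbhs_infty_ger.
  by near: n; exact: nbhs_infty_ger.
- move=> n; rewrite IT; apply: Lt; rewrite -[J n]setTI; exact: JL.
- move=> n _ [A mA [B mB <-]]; rewrite -setXI IT; apply: Lt; exact: JL.
Unshelve. all: by end_near.
Qed.

End Completeness.

(** * Bounded operators up to almost everywhere equality *)

Section BoundedOperators.
Context d (X : measurableType d) (R : realType).
Variable mu : {measure set X -> \bar R}.
Implicit Types f g : X -> R.

Lemma ip_eq0_ae f : f \in Lfun mu 2%:E -> ip mu f f = 0 -> f = (fun=> 0) %[ae mu].
Proof.
move=> fL f0; have /eqP := sqr_Lnorm mu f.
rewrite -ip_sqr // f0; have := Lnorm_ge0 mu 2%:E (EFin \o f).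
case E : ('N[mu]_2%:E[EFin \o f])%E => [r||] //.
rewrite lee_fin => r0; rewrite expe2 -EFinM -expr2 eqe sqrf_eq0 => /eqP r00.
have mf : measurable_fun setT (EFin \o f) by apply/measurable_EFinP;
  exact: L2_measurable fL.
have := @Lnorm_eq0_eq0 _ _ _ mu _ 2%:E mf; rewrite E r00 lte_fin => /(_ (ltr0n _ 2) erefl).
by apply: filterS => x /(_ I) [].
Qed.

Variable T : (X -> R) -> (X -> R).
Hypothesis bT : bounded_linear_L2 mu T.

Lemma bl_L2 f : f \in Lfun mu 2%:E -> T f \in Lfun mu 2%:E.
Proof. by case: bT => + _ _; apply. Qed.

Lemma bl_lin a f g : f \in Lfun mu 2%:E -> g \in Lfun mu 2%:E ->
  T (fun x => a * f x + g x) = (fun x => a * T f x + T g x) %[ae mu].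
Proof. by case: bT => _ + _; apply. Qed.

Lemma bl_bound : exists C : R, forall f, f \in Lfun mu 2%:E ->
  ip mu (T f) (T f) <= C * ip mu f f.
Proof.
case: bT => _ _ [C HC]; exists (C ^+ 2) => f fL.
rewrite -lee_fin EFinM !ip_sqr ?bl_L2 // -!sqr_Lnorm.
have := HC f fL; have := Lnorm_ge0 mu 2%:E (EFin \o T f);
  have := Lnorm_ge0 mu 2%:E (EFin \o f).
have /L2P[_] := fL; have /L2P[_] := bl_L2 fL; rewrite -!sqr_Lnorm.
case: ('N[mu]_2%:E[EFin \o T f])%E => [r||] //;
  case: ('N[mu]_2%:E[EFin \o f])%E => [s||] //;
  rewrite ?expe2 ?mulyy //= => _ _; rewrite -!EFinM !lee_fin => s0 r0 rs.
by rewrite -!expr2 -exprMn ler_pXn2r // nnegrE // (le_trans r0).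
Qed.

Lemma bl_ae f g : f \in Lfun mu 2%:E -> g \in Lfun mu 2%:E ->
  f = g %[ae mu] -> T f = T g %[ae mu].
Proof.
move=> fL gL fg; pose h x := - 1 * f x + g x.
have hL : h \in Lfun mu 2%:E by exact: L2_lin.
have h0 : ip mu h h = 0.
  rewrite -(ip0l mu h); apply: ip_ae => //; first exact: L20.
  by apply: filterS fg => x /= + _ => /(_ I) fx; rewrite /h fx mulN1r addNr.
have Th0 : T h = (fun=> 0) %[ae mu].
  apply: ip_eq0_ae; first exact: bl_L2.
  have [C HC] := bl_bound; apply/eqP; rewrite eq_le ip_ge0 andbT.
  by apply: le_trans (HC _ hL) _; rewrite h0 mulr0.
have := bl_lin (- 1) fL gL; apply: filterS2 Th0 => x /= + + _ => /(_ I) -> /(_ I).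
by move=> /eqP; rewrite mulN1r eq_sym addrC subr_eq0 => /eqP.
Qed.

Lemma bl0 : T (fun=> 0) = (fun=> 0) %[ae mu].
Proof.
have := bl_lin (- 1) (L20 mu) (L20 mu).
rewrite (_ : (fun=> -1 * 0 + 0) = (fun=> 0)); last by apply/funext => x;
  rewrite mulr0 addr0.
by apply: filterS => x /= + _ => /(_ I) ->; rewrite mulN1r addNr.
Qed.

Lemma bl_sum (J : eqType) (s : seq J) (a : J -> R) (F : J -> X -> R) :
  (forall j, F j \in Lfun mu 2%:E) ->
  T (fun x => \sum_(j <- s) a j * F j x) =
    (fun x => \sum_(j <- s) a j * T (F j) x) %[ae mu].
Proof.
move=> FL; elim: s => [|j s IH].
  rewrite (_ : (fun x => \sum_(j <- _) _) = (fun=> 0)); last by apply/funext => x;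
    rewrite big_nil.
  by apply: filterS bl0 => x /= + _ => /(_ I) ->; rewrite big_nil.
rewrite (_ : (fun x => \sum_(j <- _) _) = (fun x => a j * F j x +
  \sum_(i <- s) a i * F i x));
  last by apply/funext => x; rewrite big_cons.
have sL : (fun x => \sum_(j <- s) a j * F j x) \in Lfun mu 2%:E.
  by apply: L2_sum => i _; exact: L2Z.
have := bl_lin (a j) (FL j) sL; apply: filterS2 IH => x /= + + _ => /(_ I) IH /(_ I) ->.
by rewrite big_cons IH.
Qed.

(** The difference of the two sides of an adjunction formula is a bounded
    functional, so such a formula may be checked on a complete system. *)
Lemma bl_functional c G G' : G \in Lfun mu 2%:E -> G' \in Lfun mu 2%:E ->
  L2_functional mu (fun f => ip mu (T f) G - c * ip mu f G').
Proof.
move=> GL G'L; split=> [a f g fL gL|].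
  rewrite (ip_ae (bl_L2 (L2_lin a fL gL)) _ GL (bl_lin a fL gL)); last first.
    by apply: L2_lin; exact: bl_L2.
  by rewrite !ip_linl ?bl_L2 //; ring.
have [C HC] := bl_bound.
exists (2 * `|C| * ip mu G G + 2 * c ^+ 2 * ip mu G' G') => f fL.
have H1 := cauchy_schwarz (bl_L2 fL) GL; have H2 := cauchy_schwarz fL G'L.
have H3 : ip mu (T f) (T f) <= `|C| * ip mu f f.
  by apply: (le_trans (HC f fL)); rewrite ler_wpM2r ?ip_ge0 ?ler_norm.
have H4 := ler_wpM2r (ip_ge0 mu G) H3.
have H5 := ler_wpM2l (sqr_ge0 c) H2.
have H6 : (ip mu (T f) G - c * ip mu f G') ^+ 2 <=
   2 * ip mu (T f) G ^+ 2 + 2 * (c ^+ 2 * ip mu f G' ^+ 2).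
  rewrite -subr_ge0; have := sqr_ge0 (ip mu (T f) G + c * ip mu f G').
  by congr (0 <= _); ring.
apply: (le_trans H6); rewrite [leRHS]mulrDl; apply: lerD.
  have -> : 2 * `|C| * ip mu G G * ip mu f f = 2 * (`|C| * ip mu f f * ip mu G G) by ring.
  by rewrite ler_wpM2l // (le_trans H1).
have -> : 2 * c ^+ 2 * ip mu G' G' * ip mu f f =
  2 * (c ^+ 2 * (ip mu f f * ip mu G' G')) by ring.
by rewrite ler_wpM2l.
Qed.

End BoundedOperators.

(** * The dyadic shift and its action in one variable of the plane *)

Section Shift.
Context {R : realType}.
Local Notation le1 := (@lebesgue_measure R).
Local Notation le2 := (@lebesgue2 R).
Variable S : (R -> R) -> (R -> R).
Hypothesis shiftS : is_dyadic_shift S.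

Lemma shift_bl : bounded_linear_L2 le1 S. Proof. by case: shiftS. Qed.

Lemma shift_haar A : S (haar A) = haar_shift A %[ae le1].
Proof.
case: shiftS => _ He Ho; rewrite /haar_shift; case: ifPn => eA.
  by apply: He; exact/dyadic_evenP.
by apply: Ho => /dyadic_evenP; exact/negP.
Qed.

(** On the Haar functions of even intervals this says that the shift is sqrt 2
    times an isometry; for odd A both sides vanish on h_A, the left one because
    S h_A = 0 and the right one because A is not I. *)
Lemma shift_adjoint (I : dyadic) f : (2 %| I.1)%Z -> f \in Lfun le1 2%:E ->
  ip le1 (S f) (haar_shift I) = 2 * ip le1 f (haar I).
Proof.
move=> eI fL; apply/eqP; rewrite -subr_eq0; apply/eqP.
have LL := bl_functional shift_bl 2 (L2_haar_shift I) (L2_haar I).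
move: f fL; apply: (haar_complete LL) => A.
rewrite (ip_ae _ _ _ (shift_haar A)) ?L2_haar_shift ?(bl_L2 shift_bl) ?L2_haar //.
rewrite ip_haar_shift ip_haar; case: ifPn => eA; first by rewrite subrr.
by have [AI|] := eqVneq A I; [rewrite AI eI in eA|rewrite mulr0 subrr].
Qed.

Lemma acts_in_x_adjoint T (I : dyadic) w f : acts_in_x S T -> (2 %| I.1)%Z ->
  w \in Lfun le1 2%:E -> f \in Lfun le2 2%:E ->
  ip le2 (T f) (tensor (haar_shift I) w) = 2 * ip le2 f (tensor (haar I) w).
Proof.
move=> [bT HT] eI wL fL; apply/eqP; rewrite -subr_eq0; apply/eqP.
have LL := bl_functional bT 2 (L2_tensor (L2_haar_shift I) wL) (L2_tensor (L2_haar I) wL).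
move: f fL; apply: (tensor_complete LL) => u v uL vL.
have SuL := bl_L2 shift_bl uL.
rewrite (ip_ae (bl_L2 bT (L2_tensor uL vL)) _ _ (HT _ _ uL vL)) ?L2_tensor ?L2_haar_shift
  //.
rewrite !ip_tensor ?L2_haar_shift ?L2_haar // shift_adjoint //.
by rewrite -mulrA subrr.
Qed.

Lemma acts_in_y_adjoint T (J : dyadic) w f : acts_in_y S T -> (2 %| J.1)%Z ->
  w \in Lfun le1 2%:E -> f \in Lfun le2 2%:E ->
  ip le2 (T f) (tensor w (haar_shift J)) = 2 * ip le2 f (tensor w (haar J)).
Proof.
move=> [bT HT] eJ wL fL; apply/eqP; rewrite -subr_eq0; apply/eqP.
have LL := bl_functional bT 2 (L2_tensor wL (L2_haar_shift J)) (L2_tensor wL (L2_haar J)).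
move: f fL; apply: (tensor_complete LL) => u v uL vL.
have SvL := bl_L2 shift_bl vL.
rewrite (ip_ae (bl_L2 bT (L2_tensor uL vL)) _ _ (HT _ _ uL vL)) ?L2_tensor ?L2_haar_shift
  //.
rewrite !ip_tensor ?L2_haar_shift ?L2_haar // shift_adjoint //.
by rewrite mulrCA subrr.
Qed.

Definition tensor_sum (s : seq (R * (dyadic * dyadic))) (F G : dyadic -> R -> R)
    (z : R * R) : R :=
  \sum_(t <- s) t.1 * tensor (F t.2.1) (G t.2.2) z.

Lemma L2_tensor_sum s F G : (forall A, F A \in Lfun le1 2%:E) ->
  (forall A, G A \in Lfun le1 2%:E) -> tensor_sum s F G \in Lfun le2 2%:E.
Proof. by move=> FL GL; apply: L2_sum => t _; apply: L2Z; exact: L2_tensor. Qed.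

Lemma acts_in_x_sum T s G : acts_in_x S T -> (forall A, G A \in Lfun le1 2%:E) ->
  T (tensor_sum s haar G) = tensor_sum s haar_shift G %[ae le2].
Proof.
move=> [bT HT] GL.
have := bl_sum bT s (fun t => t.1) (fun t => L2_tensor (L2_haar t.2.1) (GL t.2.2)).
move=> H; apply: ae_eq_trans H _.
elim: s => [|t s IH].
  by apply: filterS (ae_eq_refl le2 setT (fun=> 0 : R)) => z _ _;
    rewrite /tensor_sum !big_nil.
have := HT _ _ (L2_haar t.2.1) (GL t.2.2) => H1.
have := tensor_ael (G t.2.2) (shift_haar t.2.1) => H2.
have H12 := ae_eq_trans H1 H2; apply: filterS2 IH H12 => z /= + + _ => /(_ Logic.I) +
  /(_ Logic.I).
by rewrite /tensor_sum !big_cons => -> ->.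
Qed.

Lemma acts_in_y_sum T s F : acts_in_y S T -> (forall A, F A \in Lfun le1 2%:E) ->
  T (tensor_sum s F haar) = tensor_sum s F haar_shift %[ae le2].
Proof.
move=> [bT HT] FL.
have := bl_sum bT s (fun t => t.1) (fun t => L2_tensor (FL t.2.1) (L2_haar t.2.2)).
move=> H; apply: ae_eq_trans H _.
elim: s => [|t s IH].
  by apply: filterS (ae_eq_refl le2 setT (fun=> 0 : R)) => z _ _;
    rewrite /tensor_sum !big_nil.
have := HT _ _ (FL t.2.1) (L2_haar t.2.2) => H1.
have := tensor_aer (F t.2.1) (shift_haar t.2.2) => H2.
have H12 := ae_eq_trans H1 H2; apply: filterS2 IH H12 => z /= + + _ => /(_ Logic.I) +
  /(_ Logic.I).
by rewrite /tensor_sum !big_cons => -> ->.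
Qed.

End Shift.

(** * The symbol as a bilinear form on step functions *)

Section Symbol.
Context {R : realType}.
Local Notation le1 := (@lebesgue_measure R).
Local Notation le2 := (@lebesgue2 R).
Implicit Types (A B : dyadic) (p q u v : R -> R).

(** A common encoding of three spaces: the dyadic step functions, the Haar span, and
    the span of the Haar functions of odd intervals. *)
Definition span_of (F : dyadic -> R -> R) (P : pred dyadic) u : Prop :=
  exists s : seq (R * dyadic), all (fun t => P t.2) s /\
    u = (fun x => \sum_(t <- s) t.1 * F t.2 x).

Definition dindic A : R -> R := \1_(dyadic_interval A).

Lemma span_of_mem F (P : pred dyadic) A : P A -> span_of F P (F A).
Proof.
move=> PA; exists [:: (1, A)]; rewrite /= PA; split=> //.
by apply/funext => x; rewrite big_seq1 mul1r.
Qed.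

Lemma span_of0 F P : span_of F P (fun=> 0).
Proof. by exists [::]; split=> //; apply/funext => x; rewrite big_nil. Qed.

Lemma span_of_lin F P a u v : span_of F P u -> span_of F P v ->
  span_of F P (fun x => a * u x + v x).
Proof.
move=> [s [sP ->]] [t [tP ->]].
exists ([seq (a * r.1, r.2) | r <- s] ++ t); split.
  by rewrite all_cat tP andbT all_map.
apply/funext => x; rewrite big_cat big_map /=; congr (_ + _).
by rewrite mulr_sumr; apply: eq_bigr => r _; rewrite mulrA.
Qed.

Lemma span_ofZ F P a u : span_of F P u -> span_of F P (fun x => a * u x).
Proof.
by move=> uP; have := span_of_lin a uP (span_of0 F P); under eq_fun do rewrite addr0.
Qed.

Lemma span_ofB F P u v : span_of F P u -> span_of F P v ->
  span_of F P (fun x => u x - v x).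
Proof.
move=> uP vP; have := span_of_lin (-1) vP uP.
by under eq_fun do rewrite mulN1r addrC.
Qed.

Lemma span_of_ind F (P : pred dyadic) (K : (R -> R) -> Prop) : K (fun=> 0) ->
  (forall a A u, P A -> span_of F P u -> K u -> K (fun x => a * F A x + u x)) ->
  forall u, span_of F P u -> K u.
Proof.
move=> K0 KS _ [s [sP ->]]; elim: s sP => [_|[a A] s IH /= /andP[PA sP]].
  by under eq_fun do rewrite big_nil.
under eq_fun do rewrite big_cons; apply: KS => //; last exact: IH.
by exists s.
Qed.

Local Notation stepf := (span_of dindic predT).
Local Notation haarf := (span_of haar predT).
Local Notation oddf := (span_of haar (fun A => ~~ (2 %| A.1)%Z)).

Lemma step_haar A : stepf (haar A).
Proof. by apply: span_ofZ; apply: span_ofB; exact: span_of_mem. Qed.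

Lemma step_haar_shift A : stepf (haar_shift A).
Proof.
rewrite /haar_shift; case: ifP => _; last exact: span_of0.
by apply: span_ofB; exact: step_haar.
Qed.

Lemma stepM u v : stepf u -> stepf v -> stepf (fun x => u x * v x).
Proof.
move=> uS vS; move: u uS; apply: span_of_ind => [|a A u _ _ IH].
  by under eq_fun do rewrite mul0r; exact: span_of0.
under eq_fun do rewrite mulrDl -mulrA.
apply: span_of_lin => //; move: v vS {IH}; apply: span_of_ind => [|b B v _ _ IH].
  by under eq_fun do rewrite mulr0; exact: span_of0.
under eq_fun do rewrite mulrDr mulrCA; apply: span_of_lin => //.
have -> : (fun x => dindic A x * dindic B x) =
  \1_(dyadic_interval A `&` dyadic_interval B) :> (R -> R).
  by rewrite indicI.
have [->|->|->] := @dyadic_setI R A B; try exact: span_of_mem.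
by rewrite indic0; exact: span_of0.
Qed.

Lemma odd_haarf u : oddf u -> haarf u.
Proof. by move=> [s [_ E]]; exists s; split=> //; exact/allP. Qed.

Lemma haar_stepf u : haarf u -> stepf u.
Proof.
move: u; apply: span_of_ind => [|a A u _ _ uS]; first exact: span_of0.
by apply: span_of_lin => //; exact: step_haar.
Qed.

Lemma step_L2 u : stepf u -> u \in Lfun le1 2%:E.
Proof.
move: u; apply: span_of_ind => [|a A u _ _ uL]; first exact: L20.
by apply: L2_lin => //; exact: L2_dyadic.
Qed.

Variable b : R * R -> R.
Hypothesis bL : L2loc b.

Lemma L2_symbol_indic A B : (fun z => b z * tensor (dindic A) (dindic B) z) \in Lfun le2
  2%:E.
Proof.
have [mb bK] := bL.
pose J A : set R := `[A.2%:~R * dyadic_length A, (A.2 + 1)%:~R * dyadic_length A]%classic.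
have JK : compact (J A `*` J B) by apply: compact_setX; exact: segment_compact.
have AJ C : (dyadic_interval C : set R) `<=` J C.
  by move=> x; rewrite /dyadic_interval /J /= !in_itv /= => /andP[-> /ltW ->].
have mAB : measurable (dyadic_interval A `*` dyadic_interval B : set (measurableTypeR R *
  measurableTypeR R)).
  by apply: measurableX; exact: measurable_dyadic.
have mJ : measurable (J A `*` J B : set (measurableTypeR R * measurableTypeR R)).
  by apply: measurableX; exact: measurable_itv.
have E : tensor (dindic A) (dindic B) = \1_(dyadic_interval A `*` dyadic_interval B).
  by apply/funext => -[x y]; rewrite /tensor /dindic /= !indicE in_setX -natrM mulnb.
apply/L2P; split.
  by apply: measurable_funM => //; rewrite E; exact: measurable_indic.
apply: le_lt_trans (bK _ JK).
rewrite [leRHS]integral_mkcond; apply: ge0_le_integral => //.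
- by move=> z _; rewrite lee_fin sqr_ge0.
- apply/measurable_EFinP/measurable_funX; apply: measurable_funM => //.
  by rewrite E; exact: measurable_indic.
- apply/(measurable_restrictT _ _).1 => //; apply/measurable_EFinP/measurable_funX.
  exact: measurable_funTS.
- move=> z _; rewrite E indicE patchE.
  have [/set_mem[Az Bz]|_] := boolP (z \in dyadic_interval A `*` dyadic_interval B).
    by rewrite mulr1 mem_set //; split; exact: AJ.
  by rewrite mulr0 expr0n; case: ifP => _; rewrite lee_fin ?sqr_ge0.
Qed.

Lemma L2_symbol u v : stepf u -> stepf v ->
  (fun z => b z * tensor u v z) \in Lfun le2 2%:E.
Proof.
move=> uS vS; move: u uS; apply: span_of_ind => [|a A u _ _ IH].
  by under eq_fun do rewrite /tensor mul0r mulr0; exact: L20.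
rewrite (_ : (fun z => _) = (fun z => a * (b z * tensor (dindic A) v z) +
  b z * tensor u v z)); last first.
  by apply/funext => z; rewrite /tensor; ring.
apply: L2_lin => //; move: v vS {IH}; apply: span_of_ind => [|c B v _ _ IH].
  by under eq_fun do rewrite /tensor mulr0 mulr0; exact: L20.
rewrite (_ : (fun z => _) = (fun z => c * (b z * tensor (dindic A) (dindic B) z) +
  b z * tensor (dindic A) v z)); last first.
  by apply/funext => z; rewrite /tensor; ring.
by apply: L2_lin => //; exact: L2_symbol_indic.
Qed.

Definition sform p q : R := (\int[le2]_z (b z * tensor p q z))%R.

(** A step function w equal to 1 on the support of u: it exhibits the symbol times
    a step function as a product of two functions in L^2. *)
Lemma step_unit u : stepf u -> exists2 w, stepf w & forall x, u x * w x = u x.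
Proof.
move: u; apply: span_of_ind => [|a A u _ _ [w wS uw]].
  by exists (fun=> 0); [exact: span_of0|move=> x; rewrite mul0r].
have AS : stepf (dindic A) by exact: span_of_mem.
exists (fun x => 1 * w x + (dindic A x - w x * dindic A x)).
  by apply: span_of_lin => //; apply: span_ofB => //; exact: stepM.
move=> x; have := uw x; have : dindic A x * dindic A x = dindic A x by exact: indic_idem.
move: (dindic A x) (u x) (w x) => i v z ii vz.
have -> : (a * i + v) * (1 * z + (i - z * i)) = a * (i * z) + a * (i * i) -
  a * z * (i * i) + v * z + i * v - i * (v * z) by ring.
by rewrite ii vz; ring.
Qed.

Lemma integrable_symbol p q : stepf p -> stepf q ->
  le2.-integrable setT (fun z => (b z * tensor p q z)%:E).
Proof.
move=> pS qS; have [w wS pw] := step_unit pS; have [w' w'S qw] := step_unit qS.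
have := L2_integrableM (L2_symbol pS qS) (L2_tensor (step_L2 wS) (step_L2 w'S)).
apply: eq_integrable => // z _; congr EFin.
by rewrite /tensor -[in RHS]pw -[in RHS]qw; ring.
Qed.

Lemma sform_linl a p p' q : stepf p -> stepf p' -> stepf q ->
  sform (fun x => a * p x + p' x) q = a * sform p q + sform p' q.
Proof.
move=> pS p'S qS; rewrite /sform -RintegralZl //; last exact: integrable_symbol.
rewrite -RintegralD //; last 2 first.
- by have := integrable_symbol (span_ofZ a pS) qS; apply: eq_integrable => // z _;
    congr EFin; rewrite /tensor; ring.
- exact: integrable_symbol.
by apply: eq_Rintegral => z _; rewrite /tensor; ring.
Qed.

Lemma sform_linr a p q q' : stepf p -> stepf q -> stepf q' ->
  sform p (fun x => a * q x + q' x) = a * sform p q + sform p q'.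
Proof.
move=> pS qS q'S; rewrite /sform -RintegralZl //; last exact: integrable_symbol.
rewrite -RintegralD //; last 2 first.
- by have := integrable_symbol pS (span_ofZ a qS); apply: eq_integrable => // z _;
    congr EFin; rewrite /tensor; ring.
- exact: integrable_symbol.
by apply: eq_Rintegral => z _; rewrite /tensor; ring.
Qed.

Lemma sform0l q : sform (fun=> 0) q = 0.
Proof.
rewrite /sform; under eq_Rintegral do rewrite /tensor mul0r mulr0.
by rewrite /Rintegral integral0.
Qed.

Lemma sform0r p : sform p (fun=> 0) = 0.
Proof.
rewrite /sform; under eq_Rintegral do rewrite /tensor mulr0 mulr0.
by rewrite /Rintegral integral0.
Qed.

Lemma ip_symbol u v u' v' : ip le2 (fun z => b z * tensor u v z) (tensor u' v') =
  sform (fun x => u x * u' x) (fun y => v y * v' y).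
Proof. by apply: eq_Rintegral => z _; rewrite /tensor; ring. Qed.

Hypothesis b_even : forall I J : dyadic, haar_coef b (I, J) != 0 ->
  dyadic_even R I /\ dyadic_even R J.

Lemma sform_haar A B : ~~ ((2 %| A.1)%Z && (2 %| B.1)%Z) -> sform (haar A) (haar B) = 0.
Proof.
move=> AB; apply/eqP; apply: contraNT AB => /b_even [eA eB].
by apply/andP; split; exact/(@dyadic_evenP R).
Qed.

Lemma sform_oddl p q : oddf p -> haarf q -> sform p q = 0.
Proof.
move=> pO qH; have qS := haar_stepf qH.
move: p pO; apply: span_of_ind => [|a A p oA /odd_haarf/haar_stepf pS IH];
  first exact: sform0l.
have AS := step_haar A; rewrite sform_linl // IH addr0.
move: q qH {qS IH}; apply: span_of_ind => [|c B q _ /haar_stepf qS IH].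
  by rewrite sform0r mulr0.
rewrite sform_linr //; last exact: step_haar.
by rewrite mulrDr IH addr0 sform_haar ?mulr0 // (negbTE oA).
Qed.

Lemma sform_oddr p q : haarf p -> oddf q -> sform p q = 0.
Proof.
move=> pH qO; have pS := haar_stepf pH.
move: q qO; apply: span_of_ind => [|a A q oA /odd_haarf/haar_stepf qS IH];
  first exact: sform0r.
have AS := step_haar A; rewrite sform_linr // IH addr0.
move: p pH {pS IH}; apply: span_of_ind => [|c B p _ /haar_stepf pS IH].
  by rewrite sform0l mulr0.
rewrite sform_linl //; last exact: step_haar.
by rewrite mulrDr IH addr0 sform_haar ?mulr0 // (negbTE oA) andbF.
Qed.

(** In one variable, this multiplies the symbol in the pairing of the commutator
    applied to h_A with the shift of h_I; in two variables the kernel is the tensor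
    product of the one-variable kernels. *)
Definition kern I A x : R :=
  2 * (haar A x * haar I x) - haar_shift A x * haar_shift I x.

(** The mean-zero part of h_A h_I; the mean is nonzero only for A = I. *)
Definition core I A x : R :=
  haar A x * haar I x - (I == A)%:R * ((dyadic_length I)^-1 * dindic I x).

Lemma haar_prod A B : A != B -> haarf (fun x => haar A x * haar B x).
Proof.
move=> /(@haarM R)[c]; move: (if _ then A else B) => C E.
rewrite (_ : (fun x => _) = (fun x => c * haar C x)); last exact/funext.
by apply: span_ofZ; exact: span_of_mem.
Qed.

Lemma haar_prod_odd A B : A != B -> ~~ (2 %| A.1)%Z -> ~~ (2 %| B.1)%Z ->
  oddf (fun x => haar A x * haar B x).
Proof.
move=> /(@haarM R)[c E] oA oB.
rewrite (_ : (fun x => _) = (fun x => c * haar (if A.1 <= B.1 then A else B) x));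
  last exact/funext.
by apply: span_ofZ; apply: span_of_mem; case: ifP.
Qed.

(** The core is 0 for A = I and a product of distinct Haar functions otherwise. *)
Lemma core_haarf I A : haarf (core I A).
Proof.
have [<-|IA] := eqVneq I A.
  rewrite (_ : core I I = (fun=> 0)); first exact: span_of0.
  by apply/funext => x; rewrite /core eqxx mul1r haar_sqr subrr.
rewrite (_ : core I A = (fun x => haar A x * haar I x)).
  by apply: haar_prod; rewrite eq_sym.
by apply/funext => x; rewrite /core (negbTE IA) mul0r subr0.
Qed.

(** For A = I the squares (T h_I)^2 and 2 h_I^2 agree. For A odd, T h_A = 0. For an
    even A other than I, (T h_A) (T h_I) consists of four products of distinct odd
    Haar functions. *)
Lemma kern_core I A : (2 %| I.1)%Z -> oddf (fun x => kern I A x - 2 * core I A x).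
Proof.
move=> eI; have oddh (B : dyadic) : (2 %| B.1)%Z -> ~~ (2 %| B.1 - 1)%Z by lia.
have [<-|IA] := eqVneq I A.
  rewrite (_ : (fun x => kern _ _ x - _) = (fun=> 0)); first exact: span_of0.
  apply/funext => x; rewrite /kern /core eqxx mul1r /haar_shift eI /dindic.
  have lr : haar (dyadic_left I) x * haar (dyadic_right I) x = 0.
    rewrite -[haar (dyadic_left _) x]haarM_indic -[haar (dyadic_right _) x]haarM_indic
      mulrACA.
    by rewrite indic_leftM_right mulr0.
  have := haar_sqr (dyadic_left I) x; have := haar_sqr (dyadic_right I) x;
    have := haar_sqr I x.
  rewrite dyadic_length_left dyadic_length_right (indic_halves I).
  move: (haar I x) (haar _ x) (haar _ x) (\1__ x) (\1__ x) (dyadic_length I) lr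
    (@dyadic_length_gt0 R I).
  move=> h r l i j n lr n0 hh rr ll.
  have -> : (r - l) * (r - l) = r * r + l * l - 2 * (l * r) by ring.
  by rewrite hh rr ll lr; field; rewrite gt_eqF.
have [eA|oA] := boolP (2 %| A.1)%Z; last first.
  rewrite (_ : (fun x => kern _ _ x - _) = (fun=> 0)); first exact: span_of0.
  by apply/funext => x; rewrite /kern /core (negbTE IA) mulr0n /haar_shift (negbTE oA);
    ring.
rewrite (_ : (fun x => kern _ _ x - _) = (fun x =>
    (haar (dyadic_right A) x * haar (dyadic_left I) x -
      haar (dyadic_right A) x * haar (dyadic_right I) x) -
    (haar (dyadic_left A) x * haar (dyadic_left I) x -
      haar (dyadic_left A) x * haar (dyadic_right I) x))).
  apply: span_ofB; apply: span_ofB; apply: haar_prod_odd;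
    rewrite ?dyadic_right_neq_left //; try exact: oddh.
  - by rewrite (inj_eq dyadic_right_inj) eq_sym.
  - by rewrite (inj_eq dyadic_left_inj) eq_sym.
  - by rewrite eq_sym dyadic_right_neq_left.
by apply/funext => x; rewrite /kern /core (negbTE IA) mulr0n /haar_shift eA eI; ring.
Qed.

(** Twice the core and the kernel differ by odd Haar functions in each variable,
    and the symbol does not see these. *)
Lemma sform_kern I J A B : (2 %| I.1)%Z -> (2 %| J.1)%Z ->
  sform (kern I A) (kern J B) = 4 * sform (core I A) (core J B).
Proof.
move=> eI eJ; pose o x := kern I A x - 2 * core I A x;
  pose o' x := kern J B x - 2 * core J B x.
have oO : oddf o by exact: kern_core.
have oO' : oddf o' by exact: kern_core.
have cH := core_haarf I A; have cH' := core_haarf J B.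
have kE : kern I A = (fun x => 2 * core I A x + o x) by apply/funext => x; rewrite /o; ring.
have kE' : kern J B = (fun x => 2 * core J B x + o' x) by apply/funext => x;
  rewrite /o'; ring.
have oH := odd_haarf oO; have oH' := odd_haarf oO'.
have kH' : haarf (kern J B) by rewrite kE'; exact: span_of_lin.
have cS := haar_stepf cH; have cS' := haar_stepf cH'.
have oS := haar_stepf oH; have oS' := haar_stepf oH'; have kS' := haar_stepf kH'.
rewrite kE sform_linl // [sform o _]sform_oddl // addr0 kE'.
by rewrite sform_linr // [sform _ o']sform_oddr //; ring.
Qed.

End Symbol.

(** * Pairing the repeated commutator with shifted Haar functions *)

Section Pairing.
Context {R : realType}.
Local Notation le1 := (@lebesgue_measure R).
Local Notation le2 := (@lebesgue2 R).
Implicit Types (I J A B : dyadic) (s : seq (R * (dyadic * dyadic))).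
Local Notation stepf := (span_of (@dindic R) predT).

Variable b : R * R -> R.
Hypothesis bL : L2loc b.

Lemma L2_mulop_sum s F G : (forall A, stepf (F A)) -> (forall A, stepf (G A)) ->
  mulop b (tensor_sum s F G) \in Lfun le2 2%:E.
Proof.
move=> FS GS; rewrite (_ : mulop _ _ = (fun z =>
  \sum_(t <- s) t.1 * (b z * tensor (F t.2.1) (G t.2.2) z))).
  by apply: L2_sum => t _; apply: L2Z; exact: L2_symbol.
apply/funext => z; rewrite /mulop /tensor_sum mulr_sumr; apply: eq_bigr => t _; ring.
Qed.

Lemma ip_mulop_sum s F G u v : (forall A, stepf (F A)) -> (forall A, stepf (G A)) ->
  stepf u -> stepf v ->
  ip le2 (mulop b (tensor_sum s F G)) (tensor u v) =
  \sum_(t <- s) t.1 * sform b (fun x => F t.2.1 x * u x) (fun y => G t.2.2 y * v y).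
Proof.
move=> FS GS uS vS.
rewrite (_ : mulop _ _ = (fun z => \sum_(t <- s) t.1 * (b z * tensor (F t.2.1) (G t.2.2)
  z))); last first.
  by apply/funext => z; rewrite /mulop /tensor_sum mulr_sumr; apply: eq_bigr => t _; ring.
have uvL : tensor u v \in Lfun le2 2%:E by apply: L2_tensor; exact: step_L2.
rewrite ip_suml // => [|t _]; last by apply: L2Z; exact: L2_symbol.
by apply: eq_bigr => t _; rewrite ipZl ?L2_symbol // ip_symbol.
Qed.

(** The product of the symbol with an arbitrary L^2 function need not be in L^2, so
    T f has to be identified with an explicit step function before b multiplies it. *)
Lemma mulop_ae f g : f \in Lfun le2 2%:E -> mulop b g \in Lfun le2 2%:E ->
  f = g %[ae le2] ->
  mulop b f \in Lfun le2 2%:E /\ mulop b f = mulop b g %[ae le2].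
Proof.
move=> fL bgL fg.
have E : mulop b f = mulop b g %[ae le2].
  by apply: filterS fg => z /= + _ => /(_ Logic.I) fz; rewrite /mulop fz.
split=> //; apply: L2_ae bgL E; apply: measurable_funM; first by case: bL.
exact: L2_measurable fL.
Qed.

Variables (S : (R -> R) -> (R -> R)) (T1 T2 : (R * R -> R) -> (R * R -> R)).
Hypotheses (shiftS : is_dyadic_shift S) (xT1 : acts_in_x S T1) (yT2 : acts_in_y S T2).

(** The product (2 h_A h_I - T h_A T h_I) (2 h_B h_J - T h_B T h_J) of two kernels
    has four terms, one for each term of the commutator: a shift to the left of b is
    removed by adjunction at the cost of a factor 2, and a shift to the right of b
    is applied to h_A (x) h_B. *)
Lemma commutator_pairing s I J : (2 %| I.1)%Z -> (2 %| J.1)%Z ->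
  repeated_commutator T1 T2 b (tensor_sum s haar haar) \in Lfun le2 2%:E /\
  ip le2 (repeated_commutator T1 T2 b (tensor_sum s haar haar))
    (tensor (haar_shift I) (haar_shift J)) =
  \sum_(t <- s) t.1 * sform b (kern I t.2.1) (kern J t.2.2).
Proof.
move=> eI eJ; set f := tensor_sum s haar haar.
pose f1 := tensor_sum s (@haar_shift R) haar; pose f2 := tensor_sum s haar (@haar_shift R).
pose f12 := tensor_sum s (@haar_shift R) (@haar_shift R).
have [bT1 _] := xT1; have [bT2 _] := yT2.
have hL := @L2_haar R; have shL := @L2_haar_shift R.
have hS := @step_haar R; have shS := @step_haar_shift R.
have fL : f \in Lfun le2 2%:E by exact: L2_tensor_sum.
have f1L : f1 \in Lfun le2 2%:E by exact: L2_tensor_sum.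
have f2L : f2 \in Lfun le2 2%:E by exact: L2_tensor_sum.
have f12L : f12 \in Lfun le2 2%:E by exact: L2_tensor_sum.
have bfL : mulop b f \in Lfun le2 2%:E by exact: L2_mulop_sum.
have bf1L : mulop b f1 \in Lfun le2 2%:E by exact: L2_mulop_sum.
have bf2L : mulop b f2 \in Lfun le2 2%:E by exact: L2_mulop_sum.
have bf12L : mulop b f12 \in Lfun le2 2%:E by exact: L2_mulop_sum.
have T1f : T1 f = f1 %[ae le2] by exact: (acts_in_x_sum shiftS s xT1 hL).
have T2f : T2 f = f2 %[ae le2] by exact: (acts_in_y_sum shiftS s yT2 hL).
have T12f : T1 (T2 f) = f12 %[ae le2].
  apply: ae_eq_trans (bl_ae bT1 (bl_L2 bT2 fL) f2L T2f) _.
  exact: (acts_in_x_sum shiftS s xT1 shL).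
have [bT1L bT1f] := mulop_ae (bl_L2 bT1 fL) bf1L T1f.
have [bT2L bT2f] := mulop_ae (bl_L2 bT2 fL) bf2L T2f.
have [bT12L bT12f] := mulop_ae (bl_L2 bT1 (bl_L2 bT2 fL)) bf12L T12f.
have XL : commutator T1 (mulop b) f \in Lfun le2 2%:E by exact: (L2B (bl_L2 bT1 bfL) bT1L).
have YL : commutator T1 (mulop b) (T2 f) \in Lfun le2 2%:E.
  exact: (L2B (bl_L2 bT1 bT2L) bT12L).
split; first exact: (L2B (bl_L2 bT2 XL) YL).
have tL u v : stepf u -> stepf v -> tensor u v \in Lfun le2 2%:E.
  by move=> uS vS; apply: L2_tensor; exact: step_L2.
rewrite /repeated_commutator [commutator T2 _ _]/commutator.
rewrite ipBl ?(bl_L2 bT2) ?tL //.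
rewrite (acts_in_y_adjoint shiftS yT2) //.
rewrite [commutator T1 _ f]/commutator ipBl ?(bl_L2 bT1) ?tL //.
rewrite (acts_in_x_adjoint shiftS xT1) //.
rewrite [commutator T1 _ (T2 f)]/commutator ipBl ?(bl_L2 bT1) ?tL //.
rewrite (acts_in_x_adjoint shiftS xT1) //.
rewrite (ip_ae bT1L bf1L _ bT1f) ?tL // (ip_ae bT2L bf2L _ bT2f) ?tL //.
rewrite (ip_ae bT12L bf12L _ bT12f) ?tL //.
rewrite !ip_mulop_sum // mulrBr mulrA !mulr_sumr -!sumrB.
apply: eq_bigr => t _.
have pS u v : stepf u -> stepf v -> stepf (fun x => u x * v x) by exact: stepM.
have kS A B : stepf (kern A B).
  rewrite (_ : kern A B = (fun x => 2 * (haar B x * haar A x) -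
    haar_shift B x * haar_shift A x)) //.
  by apply: span_ofB; [apply: span_ofZ|]; exact: pS.
have kE A B : kern A B = (fun x => (-1) * (haar_shift B x * haar_shift A x) +
    2 * (haar B x * haar A x)) :> (R -> R).
  by apply/funext => x; rewrite /kern; ring.
have hhS A B : stepf (fun x => haar A x * haar B x) by exact: pS.
have ssS A B : stepf (fun x => haar_shift A x * haar_shift B x) by exact: pS.
have hh2S A B : stepf (fun x => 2 * (haar A x * haar B x)) by exact: span_ofZ.
have Zl p q : stepf p -> stepf q -> sform b (fun x => 2 * p x) q = 2 * sform b p q.
  move=> pS' qS'; have := sform_linl bL 2 pS' (span_of0 _ _) qS'.
  by under eq_fun do rewrite addr0; rewrite sform0l addr0.
have Zr p q : stepf p -> stepf q -> sform b p (fun x => 2 * q x) = 2 * sform b p q.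
  move=> pS' qS'; have := sform_linr bL 2 pS' qS' (span_of0 _ _).
  by under eq_fun do rewrite addr0; rewrite sform0r addr0.
rewrite [kern I _]kE sform_linl // Zl // [kern J _]kE !sform_linr // !Zr //.
by ring.
Qed.

Lemma sum_sform s P Q : (forall A, stepf (P A)) -> (forall A, stepf (Q A)) ->
  \sum_(t <- s) t.1 * sform b (P t.2.1) (Q t.2.2) =
  (\int[le2]_z (b z * tensor_sum s P Q z))%R.
Proof.
move=> PS QS.
suff [] : le2.-integrable setT (fun z => (b z * tensor_sum s P Q z)%:E) /\
  \sum_(t <- s) t.1 * sform b (P t.2.1) (Q t.2.2) =
  (\int[le2]_z (b z * tensor_sum s P Q z))%R by [].
elim: s => [|t s [iS IH]].
  split.
    apply: (@eq_integrable _ _ _ le2 setT measurableT (fun=> 0%E)) => [z _|].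
      by rewrite /tensor_sum big_nil mulr0.
    exact: integrable0.
  rewrite big_nil; under eq_Rintegral do rewrite /tensor_sum big_nil mulr0.
  by rewrite /Rintegral integral0.
have it := integrable_symbol bL (span_ofZ t.1 (PS t.2.1)) (QS t.2.2).
have E z : b z * tensor_sum (t :: s) P Q z =
    b z * tensor (fun x => t.1 * P t.2.1 x) (Q t.2.2) z + b z * tensor_sum s P Q z.
  by rewrite /tensor_sum big_cons /tensor; ring.
split.
  have := integrableD measurableT it iS; apply: eq_integrable => // z _.
  by rewrite /= E EFinD.
rewrite big_cons IH; under [RHS]eq_Rintegral do rewrite E.
rewrite RintegralD //; congr (_ + _).
have := sform_linl bL t.1 (PS t.2.1) (span_of0 _ _) (QS t.2.2); rewrite sform0l addr0 => <-.
by apply: eq_Rintegral => z _; rewrite /tensor addr0.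
Qed.

(** The cores arise from the Haar functions by subtracting means over I and J. As f
    is 1 on I x J, the function f h_J has mean zero over J along each line through I,
    and likewise in the other variable, so all the corrections cancel. *)
Lemma tensor_sum_cores s I J z :
  (forall z, dyadic_rect (I, J) z -> tensor_sum s haar haar z = 1) ->
  tensor_sum s (core I) (core J) z = haar2 (I, J) z.
Proof.
move=> f1; case: z => x y; rewrite /haar2 /tensor /=.
have core0 A B u : ~ dyadic_interval A u -> core A B u = 0 :> R.
  move=> Au; rewrite /core -[haar A u]haarM_indic /dindic.
  have -> : \1_(dyadic_interval A) u = 0 :> R by rewrite indicE memNset.
  by rewrite !mulr0 subrr.
have haar0 A u : ~ dyadic_interval A u -> haar A u = 0 :> R.
  by move=> Au; rewrite -haarM_indic indicE memNset // mulr0.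
have [xI|xI] := pselect (dyadic_interval I x); last first.
  by rewrite haar0 // mul0r /tensor_sum big1 // => t _;
    rewrite /tensor core0 // mul0r mulr0.
have [yJ|yJ] := pselect (dyadic_interval J y); last first.
  by rewrite (haar0 J) // mulr0 /tensor_sum big1 // => t _;
    rewrite /tensor (core0 J) // !mulr0.
have Ey u : dyadic_interval I u -> \sum_(t <- s) t.1 * haar t.2.1 u * (J == t.2.2)%:R =
  0 :> R.
  move=> uI; transitivity (ip le1 (fun v => \sum_(t <- s) (t.1 * haar t.2.1 u) * haar
    t.2.2 v) (haar J)).
    rewrite ip_suml ?L2_haar // => [|t _]; last by apply: L2Z; exact: L2_haar.
    by apply: eq_bigr => t _; rewrite ipZl ?L2_haar // ip_haar eq_sym.
  rewrite -[RHS](@ip_haar_indic R J J (lexx _)) [RHS]ipC; apply: eq_Rintegral => v _.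
  have [vJ|vJ] := pselect (dyadic_interval J v); last by rewrite haar0 // !mulr0.
  have := f1 (u, v) (conj uI vJ); rewrite /tensor_sum => fuv.
  rewrite indicE mem_set // mul1r -[RHS]mul1r -[in RHS]fuv; congr (_ * _).
  by apply: eq_bigr => t _; rewrite /tensor mulrA.
have Ex v : dyadic_interval J v -> \sum_(t <- s) t.1 * haar t.2.2 v * (I == t.2.1)%:R =
  0 :> R.
  move=> vJ; transitivity (ip le1 (fun u => \sum_(t <- s) (t.1 * haar t.2.2 v) * haar
    t.2.1 u) (haar I)).
    rewrite ip_suml ?L2_haar // => [|t _]; last by apply: L2Z; exact: L2_haar.
    by apply: eq_bigr => t _; rewrite ipZl ?L2_haar // ip_haar eq_sym.
  rewrite -[RHS](@ip_haar_indic R I I (lexx _)) [RHS]ipC; apply: eq_Rintegral => u _.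
  have [uI|uI] := pselect (dyadic_interval I u); last by rewrite haar0 // !mulr0.
  have := f1 (u, v) (conj uI vJ); rewrite /tensor_sum => fuv.
  rewrite indicE mem_set // mul1r -[RHS]mul1r -[in RHS]fuv; congr (_ * _).
  by apply: eq_bigr => t _; rewrite /tensor /=; ring.
have Exy : \sum_(t <- s) t.1 * (I == t.2.1)%:R * (J == t.2.2)%:R = 0 :> R.
  transitivity (ip le1 (fun v => \sum_(t <- s) (t.1 * (I == t.2.1)%:R) * haar t.2.2 v)
    (haar J)).
    rewrite ip_suml ?L2_haar // => [|t _]; last by apply: L2Z; exact: L2_haar.
    by apply: eq_bigr => t _; rewrite ipZl ?L2_haar // ip_haar [t.2.2 == _]eq_sym.
  rewrite -[RHS](ip0l le1 (haar J)); apply: eq_Rintegral => v _.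
  have [vJ|vJ] := pselect (dyadic_interval J v); last by rewrite haar0 // !mulr0.
  rewrite -[in RHS](Ex v vJ); congr (_ * _); apply: eq_bigr => t _; ring.
have dI : dindic I x = 1 :> R by rewrite /dindic indicE mem_set.
have dJ : dindic J y = 1 :> R by rewrite /dindic indicE mem_set.
have := f1 (x, y) (conj xI yJ); have := Ey x xI; have := Ex y yJ; move: Exy.
rewrite /tensor_sum.
set A := \sum_(_ <- _) _; set B := \sum_(_ <- _) _; set C := \sum_(_ <- _) _;
  set D := \sum_(_ <- _) _.
move=> A0 B0 C0 D1.
transitivity (haar I x * haar J y * D - (dyadic_length J)^-1 * haar I x * C
   - (dyadic_length I)^-1 * haar J y * B + (dyadic_length I)^-1 * (dyadic_length J)^-1 * A);
  last by rewrite A0 B0 C0 D1; ring.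
rewrite /A /B /C /D !mulr_sumr -!sumrB -big_split; apply: eq_bigr => t _.
by rewrite /tensor /core /= dI dJ; ring.
Qed.

Lemma sum_cores s I J : (forall z, dyadic_rect (I, J) z -> tensor_sum s haar haar z = 1) ->
  \sum_(t <- s) t.1 * sform b (core I t.2.1) (core J t.2.2) = haar_coef b (I, J).
Proof.
move=> f1; rewrite sum_sform; [|by move=> A; exact/haar_stepf/core_haarf..].
by apply: eq_Rintegral => z _; rewrite tensor_sum_cores.
Qed.

End Pairing.

(** * Moving intervals out of a box *)

Section TestFunction.
Context {R : realType}.
Local Notation le1 := (@lebesgue_measure R).
Local Notation le2 := (@lebesgue2 R).
Implicit Types (A B : dyadic) (x : R) (s : seq (R * (dyadic * dyadic))).
Local Notation haarf := (span_of (@haar R) predT).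

(** Translating an interval of length 2^n by 2^m times its length inside an interval
    of length 2^(n + m + 1) keeps a common ancestor. Modulo the Haar span, the
    indicator of an interval is half the indicator of its parent, so the difference
    is reduced to that of the two halves of the common ancestor. *)
Lemma indic_translate_haarf (m : nat) (n k : int) : (2 %| (k %/ 2 ^+ m))%Z ->
  haarf (fun x => dindic (n, k) x - dindic (n, k + 2 ^+ m) x).
Proof.
elim: m n k => [|m IH] n k.
  rewrite expr0 divz1 => /dvdzP[l ->]; pose P : dyadic := (n + 1, l).
  rewrite (_ : (fun x => dindic _ x - _) = (fun x =>
    (- Num.sqrt (dyadic_length P)) * haar P x)).
    by apply: span_ofZ; exact: span_of_mem.
  apply/funext => x; have s0 : Num.sqrt (dyadic_length P) != 0 :> R.
    by rewrite gt_eqF // sqrtr_gt0 dyadic_length_gt0.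
  rewrite /haar /dindic mulrA mulNr mulfV // mulN1r opprB.
  by rewrite /dyadic_left /dyadic_right /= addrK mulrC.
rewrite exprS => ev.
have [c Hc] := @indic_child R (n, k); have [c' Hc'] := @indic_child R (n, k + 2 * 2 ^+ m).
rewrite /dyadic_parent /= in Hc Hc'.
have kE : ((k + 2 * 2 ^+ m) %/ 2)%Z = (k %/ 2)%Z + 2 ^+ m.
  by rewrite (_ : k + _ = 2 ^+ m * 2 + k) ?divzMDl 1?addrC //; ring.
rewrite kE in Hc'.
have : (2 %| (k %/ 2)%Z %/ 2 ^+ m)%Z by rewrite -divzMA_ge0.
move=> /(IH (n + 1)) {}IH.
rewrite (_ : (fun x => dindic _ x - _) = (fun x => 2^-1 * (dindic (n + 1, (k %/ 2)%Z) x -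
   dindic (n + 1, (k %/ 2)%Z + 2 ^+ m) x) + (c * haar (n + 1, (k %/ 2)%Z) x -
     c' * haar (n + 1, (k %/ 2)%Z + 2 ^+ m) x))).
  by apply: span_of_lin => //; apply: span_ofB; apply: span_ofZ; exact: span_of_mem.
by apply/funext => x; rewrite /dindic Hc Hc'; ring.
Qed.

Section fold.
Variable N : nat.

(** The number of generations from length 2^N down to the length of A. *)
Definition depth A : nat := `|N%:Z - A.1|%N.

(** The dyadic intervals of length at most 2^N between -2^N and 2^N. *)
Definition inbox A : bool := [&& A.1 <= N%:Z, - 2 ^+ depth A <= A.2 & A.2 < 2 ^+ depth A].

(** Translation by 2^N away from the origin: A and its image lie in the same one of
    the dyadic intervals from 0 to 2^(N + 1) and from -2^(N + 1) to 0. *)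
Definition pushout A : dyadic :=
  (A.1, if 0 <= A.2 then A.2 + 2 ^+ depth A else A.2 - 2 ^+ depth A).

(** Inverse to the translation outside the box, so that indicators of translated
    intervals are composites with [fold]. The points of the box itself are sent
    outside of the box. *)
Definition fold x : R :=
  if 2 ^+ N <= x then x - 2 ^+ N
  else if x < - 2 ^+ N then x + 2 ^+ N else x + 2 * 2 ^+ N.

Lemma expn_depth A : A.1 <= N%:Z -> (2 ^+ depth A : int)%:~R * 2 ^ A.1 = 2 ^+ N :> R.
Proof.
move=> AN; rewrite rmorphXn /= !exprnP -expfzDr // /depth; congr (_ ^ _); lia.
Qed.

Lemma pushout_haarf A : inbox A -> haarf (fun x => dindic A x - dindic (pushout A) x).
Proof.
case: A => n k /and3P[/= nN k1 k2]; rewrite /pushout /=.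
set m := depth (n, k) in k1 k2 *; have p0 : (0 : int) < 2 ^+ m by rewrite exprn_gt0.
have pE : `|2 ^+ m : int|%N = (2 ^ m)%N by rewrite abszX.
case: leP => k0.
  apply: indic_translate_haarf; rewrite divz_small ?dvdz0 // k0 /=.
  by rewrite gtz0_abs.
rewrite (_ : (fun x => dindic _ x - _) = (fun x => -1 *
   (dindic (n, k - 2 ^+ m) x - dindic (n, (k - 2 ^+ m) + 2 ^+ m) x))); last first.
  by apply/funext => x; rewrite subrK; ring.
apply: span_ofZ; apply: indic_translate_haarf.
have -> : k - 2 ^+ m = (- 2) * 2 ^+ m + (k + 2 ^+ m) by ring.
rewrite divzMDl ?gt_eqF // divz_small ?addr0 ?dvdzN //.
by apply/andP; split; [lia|rewrite gtz0_abs //; lia].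
Qed.

Lemma dindex_ge (n j : int) x : (j <= dindex n x) = (j%:~R * 2 ^ n <= x).
Proof. by rewrite /dindex floor_ge_int ler_pdivlMr // exprz_gt0. Qed.

Lemma dindex_translate (n j : int) x : dindex n (x + j%:~R * 2 ^ n) = dindex n x + j.
Proof.
apply: floor_def; have n0 : (0 : R) < 2 ^ n by exact: exprz_gt0.
rewrite mulrDl mulfK ?gt_eqF // addrAC !rmorphD /= lerD2r ltrD2r.
by have := floor_itv (x / 2 ^ n); rewrite rmorphD.
Qed.

(** This makes a translate of the indicator of any union of rectangles in the box
    an indicator again, whatever linear combination represents it. *)
Lemma dindic_pushout A x : inbox A -> dindic (pushout A) x = dindic A (fold x).
Proof.
case: A => n k /and3P[/= nN k1 k2].
rewrite /pushout /dindic !indic_dyadic /=.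
set m := depth (n, k) in k1 k2 *; have p0 : (0 : int) < 2 ^+ m by rewrite exprn_gt0.
have NE : (2 ^+ N : R) = (2 ^+ m : int)%:~R * 2 ^ n.
  by rewrite -(@expn_depth (n, k)).
have E1 : (2 ^+ N <= x) = (2 ^+ m <= dindex n x) by rewrite dindex_ge NE.
have E2 : (x < - 2 ^+ N) = (dindex n x < - 2 ^+ m).
  by rewrite !ltNge dindex_ge NE rmorphN /= mulNr.
rewrite /fold E1 E2; congr (_%:R); congr nat_of_bool.
have T j : dindex n (x + j%:~R * 2 ^ n) = dindex n x + j by exact: dindex_translate.
case: (leP (2 ^+ m) (dindex n x)) => h1.
  rewrite (_ : x - 2 ^+ N = x + (- 2 ^+ m)%:~R * 2 ^ n); last by rewrite NE rmorphN mulNr.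
  by rewrite T; case: leP => k0; lia.
case: (ltP (dindex n x) (- 2 ^+ m)) => h2; first by rewrite NE T; case: leP => k0; lia.
rewrite (_ : 2 * 2 ^+ N = (2 * 2 ^+ m : int)%:~R * 2 ^ n :> R);
  last by rewrite NE rmorphM /= mulrA.
by rewrite T; case: leP => k0; lia.
Qed.

Lemma fold_out A B x : inbox A -> inbox B -> dyadic_interval A x -> dindic B (fold x) =
  0 :> R.
Proof.
move=> iA iB xA; rewrite -dindic_pushout // /dindic indic_dyadic /=.
case: A iA xA => n k /and3P[/= nN k1 k2] /dyadic_intervalE /= xn.
case: B iB => n' k' /and3P[/= n'N k'1 k'2].
set m := depth (n, k) in k1 k2 *; set m' := depth (n', k') in k'1 k'2 *.
have p0 : (0 : int) < 2 ^+ m by rewrite exprn_gt0.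
have p0' : (0 : int) < 2 ^+ m' by rewrite exprn_gt0.
have NE : (2 ^+ m : int)%:~R * 2 ^ n = 2 ^+ N :> R by rewrite -(@expn_depth (n, k)).
have NE' : (2 ^+ m' : int)%:~R * 2 ^ n' = 2 ^+ N :> R by rewrite -(@expn_depth (n', k')).
have x1 : - 2 ^+ m' <= dindex n' x.
  by have := k1; rewrite -xn !dindex_ge !rmorphN !mulNr NE NE'.
have x2 : dindex n' x < 2 ^+ m'.
  by rewrite ltNge dindex_ge NE' -NE -dindex_ge xn -ltNge.
by case: eqP => // ; case: ifP => ? ?; lia.
Qed.

End fold.

End TestFunction.

(** * Finite unions of dyadic rectangles *)

Section TestFunction2.
Context {R : realType}.
Local Notation le1 := (@lebesgue_measure R).
Local Notation le2 := (@lebesgue2 R).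
Implicit Types (A B : dyadic) (x : R) (s : seq (R * (dyadic * dyadic))).
Local Notation haarf := (span_of (@haar R) predT).

Lemma haar_span0 : @haar_span R (fun=> 0).
Proof. by exists [::]; apply/funext => z; rewrite /tensor_sum big_nil. Qed.

Lemma haar_span_lin a (f g : R * R -> R) : haar_span f -> haar_span g ->
  haar_span (fun z => a * f z + g z).
Proof.
move=> [s ->] [t ->]; exists ([seq (a * r.1, r.2) | r <- s] ++ t).
apply/funext => z; rewrite /tensor_sum big_cat big_map /=; congr (_ + _).
by rewrite mulr_sumr; apply: eq_bigr => r _; rewrite mulrA.
Qed.

Lemma haar_span_tensor (u v : R -> R) : haarf u -> haarf v -> haar_span (tensor u v).
Proof.
move=> uH vH; move: u uH; apply: span_of_ind => [|a A u _ _ IH].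
  rewrite (_ : tensor _ _ = (fun=> 0)); first exact: haar_span0.
  by apply/funext => z; rewrite /tensor mul0r.
rewrite (_ : tensor _ _ = (fun z => a * tensor (haar A) v z + tensor u v z)); last first.
  by apply/funext => z; rewrite /tensor; ring.
apply: haar_span_lin => //; move: v vH {IH}; apply: span_of_ind => [|c B v _ _ IH].
  rewrite (_ : tensor _ _ = (fun=> 0)); first exact: haar_span0.
  by apply/funext => z; rewrite /tensor mulr0.
rewrite (_ : tensor _ _ = (fun z => c * tensor (haar A) (haar B) z +
  tensor (haar A) v z)); last first.
  by apply/funext => z; rewrite /tensor; ring.
apply: haar_span_lin => //; exists [:: (1, (A, B))].
by apply/funext => z; rewrite /tensor_sum big_seq1 mul1r.
Qed.

Lemma inbox_large N A : (`|A.1| + `|A.2| <= N)%N -> inbox N A.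
Proof.
move=> AN; have [m mE] : exists m, depth N A = (`|A.2|%N + m)%N.
  by exists (depth N A - `|A.2|)%N; rewrite /depth; lia.
have H : `|A.2| < 2 ^+ depth N A.
  rewrite mE -abszE -natrX natz ltz_nat; apply: (leq_trans (ltn_expl _ (ltnSn 1))).
  by rewrite leq_exp2l // leq_addr.
rewrite /inbox; apply/and3P; split; [lia|lia|lia].
Qed.

Lemma inbox_seq (q : seq (dyadic * dyadic)) :
  exists N, all (fun Q => inbox N Q.1 && inbox N Q.2) q.
Proof.
suff [N H] : exists N0, forall N, (N0 <= N)%N -> all (fun Q =>
  inbox N Q.1 && inbox N Q.2) q.
  by exists N; exact: H.
elim: q => [|Q q [N0 IH]]; first by exists 0%N.
exists (maxn N0 (maxn (`|Q.1.1| + `|Q.1.2|) (`|Q.2.1| + `|Q.2.2|))) => N.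
by rewrite !geq_max => /and3P[/IH qN Q1 Q2] /=; rewrite qN !inbox_large.
Qed.

(** The indicator of a union is 1_Q + 1_V - 1_Q 1_V, and the intersection of two
    dyadic rectangles is empty or a dyadic rectangle. *)
Lemma indic_dyadic_open N (q : seq (dyadic * dyadic)) :
  all (fun Q => inbox N Q.1 && inbox N Q.2) q ->
  exists s, all (fun t => inbox N t.2.1 && inbox N t.2.2) s /\
    \1_(\big[setU/set0]_(Q <- q) dyadic_rect Q) = tensor_sum s (@dindic R) (@dindic R).
Proof.
elim: q => [_|[A B] q IH /= /andP[/andP[iA iB] /IH[s [sN sE]]]].
  exists [::]; split=> //; rewrite big_nil indic0.
  by apply/funext => z; rewrite /tensor_sum big_nil.
have [t [tN tE]] : exists t, all (fun t => inbox N t.2.1 && inbox N t.2.2) t /\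
    (fun z => tensor (dindic A) (dindic B) z * tensor_sum s (@dindic R) (@dindic R) z) =
     tensor_sum t (@dindic R) (@dindic R).
  elim: s sN {sE} => [_|[c [C D]] s IHs /= /andP[/andP[iC iD] /IHs[t [tN tE]]]].
    by exists [::]; split=> //; apply/funext => z; rewrite /tensor_sum !big_nil mulr0.
  have M A' B' : (forall z, dindic A' z * dindic B' z =
    \1_(dyadic_interval A' `&` dyadic_interval B') z :> R).
    by move=> z; rewrite indicI.
  have H A' B' : inbox N A' -> inbox N B' -> (forall z, dindic A' z * dindic B' z =
    0 :> R) \/
     exists2 E, inbox N E & forall z, dindic A' z * dindic B' z = dindic E z :> R.
    move=> iA' iB'; have [E|E|E] := @dyadic_setI R A' B'.
    - by left=> z; rewrite M E indic0.
    - by right; exists A' => // z; rewrite M E.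
    - by right; exists B' => // z; rewrite M E.
  have cons z : tensor (dindic A) (dindic B) z * tensor_sum ((c, (C, D)) :: s) (@dindic
    R) (@dindic R) z =
      c * ((dindic A z.1 * dindic C z.1) * (dindic B z.2 * dindic D z.2)) +
        tensor_sum t (@dindic R) (@dindic R) z.
    by rewrite -tE /tensor_sum big_cons /tensor /=; ring.
  have [ac|[E iE ac]] := H A C iA iC.
    by exists t; split=> //; apply/funext => z; rewrite cons ac mul0r mulr0 add0r.
  have [bd|[F iF bd]] := H B D iB iD.
    by exists t; split=> //; apply/funext => z; rewrite cons bd !mulr0 add0r.
  exists ((c, (E, F)) :: t); split; first by rewrite /= iE iF.
  by apply/funext => z; rewrite cons ac bd [in RHS]/tensor_sum big_cons.
exists ((1, (A, B)) :: s ++ [seq (- r.1, r.2) | r <- t]); split.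
  rewrite /= iA iB all_cat sN all_map; exact: tN.
apply/funext => z; rewrite big_cons.
transitivity (tensor (dindic A) (dindic B) z + tensor_sum s (@dindic R) (@dindic R) z -
   tensor (dindic A) (dindic B) z * tensor_sum s (@dindic R) (@dindic R) z).
  rewrite -sE !indicE in_setU /tensor /dindic !indicE -natrM mulnb.
  have -> : (z \in dyadic_rect (A, B)) = (z.1 \in dyadic_interval A) && (z.2 \in
    dyadic_interval B).
    by case: z => x y; rewrite /dyadic_rect in_setX.
  by case: (_ && _); case: (_ \in _); rewrite /= ?mulr1n ?mulr0n; ring.
rewrite (congr1 (fun f => f z) tE) /tensor_sum big_cons big_cat big_map /= mul1r -addrA;
  congr (_ + (_ + _)).
by rewrite -sumrN; apply: eq_bigr => r _; rewrite mulNr.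
Qed.

Lemma ip_add_le (f g : R * R -> R) : f \in Lfun le2 2%:E -> g \in Lfun le2 2%:E ->
  ip le2 (fun z => f z - g z) (fun z => f z - g z) <= 2 * (ip le2 f f + ip le2 g g).
Proof.
move=> fL gL; have := ip_ge0 le2 (fun z => 1 * f z + g z); rewrite ip_quadratic //.
rewrite (_ : (fun z => f z - g z) = (fun z => - 1 * g z + f z));
  last by apply/funext => z; ring.
by rewrite ip_quadratic // (ipC le2 g f); lra.
Qed.

Lemma ip_idem (f : R * R -> R) : (forall z, f z * f z = f z) -> ip le2 f f =
  (\int[le2]_z f z)%R.
Proof. by move=> ff; apply: eq_Rintegral => z _; rewrite ff. Qed.

(** The integral depends on the lengths only, so it does not change when intervals
    are translated. *)
Lemma integral_tensor_sum_dindic s (p r : dyadic -> dyadic) :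
  (forall A, dyadic_length (p A) = dyadic_length A :> R) ->
  (forall A, dyadic_length (r A) = dyadic_length A :> R) ->
  (\int[le2]_z tensor_sum s (fun A => dindic (p A)) (fun A => dindic (r A)) z)%R =
  \sum_(t <- s) t.1 * (dyadic_length t.2.1 * dyadic_length t.2.2).
Proof.
move=> pE rE.
have ti A B : tensor (dindic (p A)) (dindic (r B)) \in Lfun le2 2%:E.
  by apply: L2_tensor; exact: L2_dyadic.
have ii A B z : tensor (dindic A) (dindic B) z * tensor (dindic A) (dindic B) z =
    tensor (dindic A) (dindic B) z :> R.
  by rewrite /tensor mulrACA; congr (_ * _); exact: indic_idem.
have iE A B : le2.-integrable setT (EFin \o tensor (dindic (p A)) (dindic (r B))).
  have := L2_integrableM (ti A B) (ti A B); apply: eq_integrable => // z _.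
  by rewrite /= ii.
suff [] : le2.-integrable setT (EFin \o tensor_sum s (fun A => dindic (p A)) (fun A =>
  dindic (r A))) /\
  (\int[le2]_z tensor_sum s (fun A => dindic (p A)) (fun A => dindic (r A)) z)%R =
  \sum_(t <- s) t.1 * (dyadic_length t.2.1 * dyadic_length t.2.2) by [].
elim: s => [|t s [iS IH]].
  split.
    apply: (@eq_integrable _ _ _ le2 setT measurableT (fun=> 0%E)) => [z _|].
      by rewrite /tensor_sum /= big_nil.
    exact: integrable0.
  rewrite big_nil; under eq_Rintegral do rewrite /tensor_sum big_nil.
  by rewrite /Rintegral integral0.
have E z : tensor_sum (t :: s) (fun A => dindic (p A)) (fun A => dindic (r A)) z =
    t.1 * tensor (dindic (p t.2.1)) (dindic (r t.2.2)) z +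
    tensor_sum s (fun A => dindic (p A)) (fun A => dindic (r A)) z.
  by rewrite /tensor_sum big_cons.
have it : le2.-integrable setT (fun z => (t.1 * tensor (dindic (p t.2.1)) (dindic (r
  t.2.2)) z)%:E).
  have := integrableZl measurableT t.1 (iE t.2.1 t.2.2).
  by apply: eq_integrable => // z _; rewrite /= EFinM.
split.
  have := integrableD measurableT it iS; apply: eq_integrable => // z _.
  by rewrite /= E EFinD.
under eq_Rintegral do rewrite E.
rewrite RintegralD // IH big_cons; congr (_ + _); rewrite RintegralZl //; congr (_ * _).
rewrite -ip_idem; last by move=> z; rewrite ii.
by rewrite ip_tensor ?L2_dyadic // !ip_indic_same pE rE.
Qed.

End TestFunction2.

(** * The test function *)

Section TestFunction3.
Context {R : realType}.
Local Notation le1 := (@lebesgue_measure R).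
Local Notation le2 := (@lebesgue2 R).

Lemma measurable_dyadic_open (U : set (R * R)) : dyadic_open U ->
  measurable (U : set (measurableTypeR R * measurableTypeR R)).
Proof.
move=> [q ->]; elim: q => [|Q q IH]; first by rewrite big_nil.
rewrite big_cons; apply: measurableU => //.
by apply: measurableX; exact: measurable_dyadic.
Qed.

(** Replacing every 1_A in the representation of 1_U by 1_A minus its translate out
    of the box puts it in the Haar span. This produces 1_U and three translates of
    it, which vanish on U and have the same norm as 1_U. *)
Lemma exists_test_function (U : set (R * R)) : dyadic_open U ->
  exists (c : R) s, [/\ le2 U = c%:E, forall z, U z -> tensor_sum s haar haar z = 1 :> R &
    ip le2 (tensor_sum s haar haar) (tensor_sum s haar haar) <= 16 * c].
Proof.
move=> oU; have mU := measurable_dyadic_open oU; move: oU => [q qU];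
  have [N qN] := inbox_seq q.
have [s [sN]] := @indic_dyadic_open R _ _ qN; rewrite -qU => sU.
pose D := @dindic R; pose P A : R -> R := dindic (pushout N A).
have DL A : D A \in Lfun le1 2%:E by exact: L2_dyadic.
have PL A : P A \in Lfun le1 2%:E by exact: L2_dyadic.
have in_seq t : t \in s -> inbox N t.2.1 /\ inbox N t.2.2.
  by move=> ts; move/allP: sN => /(_ t ts)/andP[].
have gPD z : tensor_sum s P D z = \1_U (fold N z.1, z.2).
  rewrite sU; apply: eq_big_seq => t /in_seq[t1 t2].
  by rewrite /tensor /P dindic_pushout.
have gDP z : tensor_sum s D P z = \1_U (z.1, fold N z.2).
  rewrite sU; apply: eq_big_seq => t /in_seq[t1 t2].
  by rewrite /tensor /P dindic_pushout.
have gPP z : tensor_sum s P P z = \1_U (fold N z.1, fold N z.2).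
  rewrite sU; apply: eq_big_seq => t /in_seq[t1 t2].
  by rewrite /tensor /P !dindic_pushout.
have idem (z : R * R) : \1_U z * \1_U z = \1_U z :> R by rewrite indicE -natrM mulnb andbb.
have mass : \int[le2]_z \1_U z = \sum_(t <- s) t.1 * (dyadic_length t.2.1 * dyadic_length
  t.2.2).
  by rewrite sU; exact: (@integral_tensor_sum_dindic R s id id).
have nPD : ip le2 (tensor_sum s P D) (tensor_sum s P D) = ip le2 \1_U \1_U.
  rewrite !ip_idem // => [|z]; last by rewrite gPD idem.
  by rewrite mass; exact: (@integral_tensor_sum_dindic R s (pushout N) id).
have nDP : ip le2 (tensor_sum s D P) (tensor_sum s D P) = ip le2 \1_U \1_U.
  rewrite !ip_idem // => [|z]; last by rewrite gDP idem.
  by rewrite mass; exact: (@integral_tensor_sum_dindic R s id (pushout N)).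
have nPP : ip le2 (tensor_sum s P P) (tensor_sum s P P) = ip le2 \1_U \1_U.
  rewrite !ip_idem // => [|z]; last by rewrite gPP idem.
  by rewrite mass; exact: (@integral_tensor_sum_dindic R s (pushout N) (pushout N)).
have UL : (\1_U : R * R -> R) \in Lfun le2 2%:E by rewrite sU; exact: L2_tensor_sum.
have UE : le2 U = (ip le2 \1_U \1_U)%:E.
  rewrite ip_sqr // -[LHS](_ : (\int[le2]_z (\1_U z)%:E)%E = _).
    by apply: eq_integral => z _; rewrite expr2 idem.
  by rewrite integral_indic // setIT.
pose e A : R -> R := fun x => D A x - P A x.
have [r rE] : exists r, tensor_sum s e e = tensor_sum r haar haar.
  change (haar_span (tensor_sum s e e)).
  elim: s sN {sU in_seq gPD gDP gPP mass nPD nDP nPP} =>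
    [_|[c [A B]] s IH /= /andP[/andP[iA iB] /IH {}IH]].
    rewrite (_ : tensor_sum _ _ _ = (fun=> 0)); first exact: haar_span0.
    by apply/funext => z; rewrite /tensor_sum big_nil.
  rewrite (_ : tensor_sum _ _ _ = (fun z => c * tensor (e A) (e B) z +
    tensor_sum s e e z)); last first.
    by apply/funext => z; rewrite /tensor_sum big_cons.
  by apply: haar_span_lin => //; apply: haar_span_tensor; exact: pushout_haarf.
have eE z : tensor_sum s e e z = (\1_U z - tensor_sum s P D z) - (tensor_sum s D P z -
  tensor_sum s P P z).
  rewrite sU /tensor_sum -!sumrB; apply: eq_bigr => t _.
  by rewrite /tensor /e /D; ring.
have out z : U z -> [/\ tensor_sum s P D z = 0, tensor_sum s D P z =
  0 & tensor_sum s P P z = 0].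
  rewrite qU -bigcup_seq => -[[A B] /= /(allP qN)/= /andP[iA iB] [/= zA zB]].
  split; rewrite /tensor_sum big_seq big1 // => t /in_seq[t1 t2]; rewrite /tensor /P.
  - by rewrite dindic_pushout // (fold_out iA t1) // mul0r mulr0.
  - by rewrite [dindic (pushout _ _) _]dindic_pushout // (fold_out iB t2) // !mulr0.
  - by rewrite dindic_pushout // (fold_out iA t1) // mul0r mulr0.
exists (ip le2 \1_U \1_U), r; rewrite -rE; split=> // [z Uz|].
  by have [z1 z2 z3] := out z Uz; rewrite eE z1 z2 z3 indicE mem_set // !subr0.
have gL F G : (forall A, F A \in Lfun le1 2%:E) -> (forall A, G A \in Lfun le1 2%:E) ->
  tensor_sum s F G \in Lfun le2 2%:E by exact: L2_tensor_sum.
rewrite (_ : tensor_sum s e e = (fun z => (\1_U z - tensor_sum s P D z) -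
  (tensor_sum s D P z - tensor_sum s P P z))); last exact/funext.
have h1 := ip_add_le UL (gL _ _ PL DL).
have h2 := ip_add_le (gL _ _ DL PL) (gL _ _ PL PL).
apply: (le_trans (ip_add_le (L2B UL (gL _ _ PL DL)) (L2B (gL _ _ DL PL) (gL _ _ PL PL)))).
move: h1 h2; rewrite nPD nDP nPP; lra.
Qed.

End TestFunction3.


(** * The lower bound for the repeated commutator *)

Theorem theorem9p2 (R : realType) :
  exists C1 : R,
    forall (S : (R -> R) -> (R -> R)) (T1 T2 : (R * R -> R) -> (R * R -> R)),
      is_dyadic_shift S -> acts_in_x S T1 -> acts_in_y S T2 ->
    forall b : R * R -> R, L2loc b ->
      (forall I J : dyadic, haar_coef b (I, J) != 0 ->
         dyadic_even R I /\ dyadic_even R J) ->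
    forall U0 : set (R * R), dyadic_open U0 ->
      (\esum_(Q in [set Q | dyadic_rect Q `<=` U0]) (haar_coef b Q ^+ 2)%:E
        <= C1%:E * haar_opnorm (repeated_commutator T1 T2 b) ^+ 2
             * lebesgue2 U0)%E.
Proof.
exists 4 => S T1 T2 shiftS xT1 yT2 b bL b_even U oU.
have mU := measurable_dyadic_open oU.
have [c [s [UE sU fU]]] := exists_test_function oU.
set T := repeated_commutator T1 T2 b; set N := haar_opnorm T.
have hL := @L2_haar R.
have pL r : tensor_sum r haar haar \in Lfun (@lebesgue2 R) 2%:E by exact: L2_tensor_sum.
have TL r : T (tensor_sum r haar haar) \in Lfun (@lebesgue2 R) 2%:E.
  (* Any pair of even intervals will do here. *)
  by have [] := commutator_pairing bL shiftS xT1 yT2 r (I := (0, 0)) (J := (0, 0)) isT isT.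
have TN r : ip lebesgue2 (tensor_sum r haar haar) (tensor_sum r haar haar) <= 1 ->
    ('N[@lebesgue2 R]_2%:E[EFin \o T (tensor_sum r haar haar)] <= N)%E.
  move=> r1; apply: ereal_sup_ubound; exists (tensor_sum r haar haar) => //; split;
    first by exists r.
  have := Lnorm_ge0 (@lebesgue2 R) 2%:E (EFin \o tensor_sum r haar haar).
  have := sqr_Lnorm (@lebesgue2 R) (tensor_sum r haar haar); rewrite -ip_sqr //.
  case: ('N[_]__[_])%E => [x||]; rewrite ?expe2 ?mulyy // -EFinM => -[E];
    rewrite !lee_fin => x0; move: r1; rewrite -E; nra.
have N0 : (0 <= N)%E.
  apply: (le_trans (Lnorm_ge0 _ 2%:E _) (TN [::] _)).
  rewrite (_ : tensor_sum _ _ _ = (fun=> 0)) ?ip0l //.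
  by apply/funext => z; rewrite /tensor_sum big_nil.
rewrite UE; apply: ub_ereal_sup => _ [A [finA AU] <-].
rewrite fsbig_finite //=.
set q := finmap.enum_fset _.
have qU Q : Q \in q -> dyadic_rect Q `<=` U.
  by move=> Qq; apply: AU; move: Qq; rewrite in_fset_set // inE.
have uq : uniq q by exact: finmap.fset_uniq.
rewrite sumEFin.
have [q0|[Q0 Q0q]] : q = [::] \/ exists Q, Q \in q.
  by case: (q) => [|Q q']; [left|right; exists Q; rewrite mem_head].
  rewrite q0 big_nil; apply: mule_ge0; last by rewrite -UE measure_ge0.
  by apply: mule_ge0 => //; exact: sqre_ge0.
have c0 : 0 < c.
  have mQ : measurable (dyadic_rect Q0 : set (measurableTypeR R * measurableTypeR R)).
    by apply: measurableX; exact: measurable_dyadic.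
  have QU : (lebesgue2 (dyadic_rect Q0) <= lebesgue2 U)%E.
    by apply: le_measure; rewrite ?inE //; exact: qU.
  have QE : lebesgue2 (dyadic_rect Q0) = (dyadic_length Q0.1 * dyadic_length Q0.2 : R)%:E.
    transitivity (@lebesgue_measure R (dyadic_interval Q0.1) * @lebesgue_measure R
      (dyadic_interval Q0.2))%E.
      by apply: product_measure1E; exact: measurable_dyadic.
    by rewrite [X in (X * _)%E]lebesgue_dyadic [X in (_ * X)%E]lebesgue_dyadic.
  rewrite -lte_fin -UE (lt_le_trans _ QU) // QE lte_fin.
  by apply: mulr_gt0; exact: dyadic_length_gt0.
(* The factor that makes the norm of the test function at most 1. *)
pose a := (4 * Num.sqrt c)^-1.
have a2 : a ^+ 2 * 16 * c = 1.
  rewrite /a exprVn exprMn sqr_sqrtr ?ltW //.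
  by field; rewrite gt_eqF.
pose r := [seq (a * t.1, t.2) | t <- s].
have rE z : tensor_sum r haar haar z = a * tensor_sum s haar haar z :> R.
  by rewrite /tensor_sum big_map mulr_sumr; apply: eq_bigr => t _; exact/esym/mulrA.
have r1 : ip lebesgue2 (tensor_sum r haar haar) (tensor_sum r haar haar) <= 1.
  rewrite (_ : tensor_sum r haar haar = (fun z => a * tensor_sum s haar haar z));
    last exact/funext.
  rewrite ipZl ?L2Z // ipC ipZl // mulrA -expr2 -a2 -mulrA.
  by rewrite ler_wpM2l ?sqr_ge0.
pose G (Q : dyadic * dyadic) : R * R -> R := tensor (haar_shift Q.1) (haar_shift Q.2).
have GL Q : G Q \in Lfun (@lebesgue2 R) 2%:E by apply: L2_tensor; exact: L2_haar_shift.
have GG Q Q' : ip lebesgue2 (G Q) (G Q') = ip (@lebesgue_measure R) (haar_shift Q.1)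
  (haar_shift Q'.1) *
    ip (@lebesgue_measure R) (haar_shift Q.2) (haar_shift Q'.2).
  by rewrite ip_tensor ?L2_haar_shift.
have pairing Q : Q \in q -> ip lebesgue2 (T (tensor_sum r haar haar)) (G Q) =
  4 * a * haar_coef b Q.
  case: Q => I J /qU QU.
  have [/andP[eI eJ]|odd] := boolP ((2 %| I.1)%Z && (2 %| J.1)%Z); last first.
    have -> : haar_coef b (I, J) = 0 by exact: (sform_haar b_even).
    rewrite mulr0 ipC; rewrite -[RHS](ip0l (@lebesgue2 R) (T (tensor_sum r haar haar))).
    apply: ip_ext => z; rewrite /G /tensor /haar_shift /=.
    by move: odd; rewrite negb_and => /orP[/negbTE ->|/negbTE ->]; rewrite ?mul0r ?mulr0.
  have [_ ->] := commutator_pairing bL shiftS xT1 yT2 r eI eJ.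
  rewrite big_map -(sum_cores bL (s := s)); last by move=> z /QU; exact: sU.
  rewrite mulr_sumr; apply: eq_bigr => t _ /=.
  by rewrite (sform_kern bL b_even) //; ring.
have := @bessel _ _ _ (@lebesgue2 R) _ q G 4 (T (tensor_sum r haar haar)) (ltr0n _ 4) uq
  (TL r) GL.
have H1 Q : Q \in q -> ip lebesgue2 (G Q) (G Q) <= 4.
  move=> _; rewrite GG !ip_haar_shift !eqxx mulr1.
  by case: ifP => _; case: ifP => _; rewrite ?mul0r ?mulr0 //; lra.
have H2 Q Q' : Q \in q -> Q' \in q -> Q != Q' -> ip lebesgue2 (G Q) (G Q') = 0.
  move=> _ _; case: Q Q' => I J [I' J']; rewrite xpair_eqE negb_and GG !ip_haar_shift /=.
  by case/orP => /negbTE ->; do 2 case: ifP => _; rewrite ?mulr0 ?mul0r.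
move=> /(_ H1 H2); rewrite (eq_big_seq (fun Q => (4 * a) ^+ 2 * haar_coef b Q ^+ 2));
  last first.
  by move=> Q /pairing ->; rewrite exprMn.
rewrite -mulr_sumr; set B := \sum_(_ <- _) _; set F := ip _ _ _ => BF.
have {}BF : B <= 4 * F * c.
  have := ler_wpM2r (ltW c0) BF.
  have -> : (4 * a) ^+ 2 * B * c = (a ^+ 2 * 16 * c) * B by ring.
  by rewrite a2 mul1r.
have FN : (F%:E <= N ^+ 2)%E.
  rewrite /F ip_sqr // -sqr_Lnorm !expe2; apply: lee_pmul => //; first exact: Lnorm_ge0.
  - exact: Lnorm_ge0.
  - exact: TN.
  - exact: TN.
apply: (@le_trans _ _ ((4 * F * c)%:E)); first by rewrite lee_fin.
rewrite !EFinM lee_wpmul2r ?lee_fin ?(ltW c0) //.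
by rewrite lee_wpmul2l // lee_fin.
Qed.
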